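(* For every $K>0$ there exists a constant $\alpha>0$ depending only on $K$ such that the following holds. Let $n,m,d_1,d_2$ be positive integers with $nd_1=md_2$, $d_1\le m$, $d_2\le n$, $d_1\ge d_2$ and $d_2\le \frac12 n^{2/3}$, and let $A$ be the adjacency matrix of a uniformly random $(n,m,d_1,d_2)$-bipartite biregular graph. Then $$\mathbb P\left(\lambda_2(A)\le \alpha\sqrt{d_1}\right)\ge 1-m^{-K}-e^{-m}.$$
   Context: An $(n,m,d_1,d_2)$-bipartite biregular graph is a simple bipartite graph with (labelled, disjoint) vertex classes $V_1=[n]$ and $V_2=[m]$ in which every vertex of $V_1$ has degree $d_1$ and every vertex of $V_2$ has degree $d_2$ (so $nd_1=md_2$). ''Uniformly random'' means uniform on the finite set of all such labelled graphs. Its biadjacency matrix is $X\in\{0,1\}^{n\times m}$ with $X_{uv}=1$ iff $u\in V_1$ and $v\in V_2$ are adjacent, and its adjacency matrix is the $(n+m)\times(n+m)$ matrix $A=\begin{bmatrix}0&X\\ X^{\top}&0\end{bmatrix}$. The eigenvalues of $A$ are ordered $\lambda_1(A)\ge\lambda_2(A)\ge\dots\ge\lambda_{n+m}(A)$. *)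

(* Defs.v *)
From mathcomp Require Import all_boot all_order all_algebra.
From mathcomp Require Import sesquilinear spectral complex.
From mathcomp Require Import boolp classical_sets reals.

Set Implicit Arguments.
Unset Strict Implicit.
Unset Printing Implicit Defensive.

Import Order.TTheory GRing.Theory Num.Theory.
Local Open Scope ring_scope.

(* The edge set of a bipartite graph on the disjoint labelled classes 'I_n and
   'I_m; since the classes are disjoint, such a graph is an arbitrary subset of
   the product, and it is automatically simple. *)
Definition bigraph (n m : nat) := {set 'I_n * 'I_m}.

Definition ldeg n m (G : bigraph n m) (u : 'I_n) : nat :=
  #|[set v : 'I_m | (u, v) \in G]|.

Definition rdeg n m (G : bigraph n m) (v : 'I_m) : nat :=
  #|[set u : 'I_n | (u, v) \in G]|.

Definition biregular (n m d1 d2 : nat) : {set bigraph n m} :=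
  [set G : bigraph n m |
     [forall u, ldeg G u == d1] && [forall v, rdeg G v == d2]].

(* Probability of P under the uniform law on S; the value is 0 when S is empty,
   but a biregular set is nonempty whenever n * d1 = m * d2, d1 <= m, d2 <= n. *)
Definition uniform_pr (R : realType) (T : finType) (S : {set T})
    (P : pred T) : R :=
  #|[set x in S | P x]|%:R / #|S|%:R.

Definition biadj_mx (R : realType) n m (G : bigraph n m) : 'M[R]_(n, m) :=
  \matrix_(u, v) ((u, v) \in G)%:R.

Definition adj_mx (R : realType) n m (G : bigraph n m) : 'M[R]_(n + m) :=
  block_mx 0 (biadj_mx R G) (biadj_mx R G)^T 0.

Definition is_spectrum (R : realType) N (A : 'M[R]_N) (s : seq R) : Prop :=
  sorted >=%R s /\ char_poly A = \prod_(x <- s) ('X - x%:P).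

(* The eigenvalues of A with multiplicity, in nonincreasing order. The default
   value [::] is only taken when the characteristic polynomial does not split
   over R, which is impossible for a symmetric A (spectrumP). *)
Definition spectrum (R : realType) N (A : 'M[R]_N) : seq R :=
  xget [::] [set s | is_spectrum A s].

(* Numbered from 1: eig A 1 is the largest eigenvalue of A. *)
Definition eig (R : realType) N (A : 'M[R]_N) (k : nat) : R :=
  nth 0 (spectrum A) k.-1.

Lemma is_spectrum_uniq (R : realType) N (A : 'M[R]_N) (s t : seq R) :
  is_spectrum A s -> is_spectrum A t -> s = t.
Proof.
move=> [ss es] [st et]; apply: (sorted_eq (leT := >=%R)) => //.
- by move=> x y z /= xy yz; exact: le_trans yz xy.
- by move=> x y /= yx; apply/le_anti; rewrite andbC.
- by apply: prod_XsubC_eq; rewrite -es -et.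
Qed.

Lemma is_spectrum_ex (R : realType) N (A : 'M[R]_N) :
  A^T = A -> exists s, is_spectrum A s.
Proof.
move=> symA; pose f := real_complex R.
pose B : 'M[R[i]]_N := map_mx f A.
have hB : B \is hermsymmx.
  apply: realsym_hermsym.
    by apply/is_hermitianmxP; rewrite expr0 scale1r map_mx_id // /B map_trmx symA.
  apply/mxOverP => i j; rewrite mxE; apply/complex_realP; by exists (A i j).
have rD := hermitian_spectral_diag_real hB.
have /orthomx_spectralP EB := hermitian_normalmx hB.
pose d j := complex.Re (spectral_diag B 0 j).
have dE j : spectral_diag B 0 j = f (d j).
  by rewrite /d; have /mxOverP/(_ 0 j)/complex_realP[k ->] := rD.
have cpB : char_poly B = \prod_j ('X - (f (d j))%:P).
  have uP := spectral_unit B.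
  move: EB uP; set P := spectralmx B => EB uP.
  have -> : char_poly B = char_poly (diag_mx (spectral_diag B)).
    rewrite /char_poly /char_poly_mx {1}EB !map_mxM /=.
    set Q := map_mx _ (invmx P); set S := map_mx _ P; set D := map_mx _ (diag_mx _).
    have QS : Q *m S = 1%:M by rewrite -map_mxM mulVmx // map_mx1.
    have -> : 'X%:M - Q *m D *m S = Q *m ('X%:M - D) *m S.
      by rewrite mulmxBr mulmxBl scalar_mxC -(mulmxA _ Q S) QS mulmx1.
    by rewrite !det_mulmx mulrAC -det_mulmx QS det1 mul1r.
  rewrite char_poly_trig ?diag_mx_is_trig //.
  by apply: eq_bigr => j _; rewrite mxE eqxx mulr1n dE.
exists (sort >=%R [seq d j | j <- enum 'I_N]); split.
  by apply: sort_sorted => x y; exact: le_total.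
have -> : \prod_(x <- sort >=%R [seq d j | j <- enum 'I_N]) ('X - x%:P)
    = \prod_j ('X - (d j)%:P).
  by rewrite (perm_big _ (permEl (perm_sort _ _))) big_map big_enum.
apply: (map_poly_inj f).
rewrite map_char_poly cpB rmorph_prod.
by apply: eq_bigr => j _; rewrite rmorphB /= map_polyX map_polyC.
Qed.

Lemma spectrumP (R : realType) N (A : 'M[R]_N) :
  A^T = A -> is_spectrum A (spectrum A).
Proof. by move=> /is_spectrum_ex/(xgetPex [::]). Qed.

Lemma adj_mx_sym (R : realType) n m (G : bigraph n m) :
  (adj_mx R G)^T = adj_mx R G.
Proof. by rewrite /adj_mx tr_block_mx !trmx0 trmxK. Qed.

(* Main.v *)
Require Import Defs.
From mathcomp Require Import all_boot all_order all_algebra.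
From mathcomp Require Import sesquilinear spectral complex.
From mathcomp Require Import reals sequences exp.
From mathcomp Require Import ring lra zify.

Import Order.TTheory GRing.Theory Num.Theory.
Local Open Scope ring_scope.

(** Kahn-Szemeredi argument.  Put d = d2, p = d2 / n, and let X be the
    biadjacency matrix.  Any vector orthogonal to the all-ones vector splits as
    (x, y) with (sum x)(sum y) <= 0, so it suffices to bound the bilinear form
    of X - p J, and by rounding it suffices to do so on integer vectors k, l with
    |k|^2 <= 16 n and |l|^2 <= 16 m: the form must be O(m sqrt d) there.

    Light couples, |k_u l_v| <= sqrt d.  For f = sum Q_uv X_uv, a simple switching
    replaces edges uv, u'v' by uv', u'v and changes f by a quantity Delta that
    does not depend on the graph.  Up to forbidden switchings the total drift of
    f over all switchings is 2 n d1 (f - p sum Q), while reversibility turns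
    E[Delta e^(theta f)] into E[Delta (1 - e^(- theta Delta)) e^(theta f)] / 2, which is
    of second order in Delta.  The forbidden switchings are paths of three edges
    and cost O(d1 d2), which is O(m sqrt d) exactly when d2 = O(n^(2/3)).  At
    theta = 1 / sqrt d this gives a failure probability e^(-37 m), which beats
    the e^(36 m) points of the grid.

    Heavy couples.  The same switchings bound the upper tail of the number of
    edges between two vertex sets; a union bound gives, with probability
    1 - m^(-K), a discrepancy property, from which the heavy sum is bounded
    deterministically by a dyadic (base 4) decomposition. *)

(** * Switchings and exponential moments *)

(* Since [1 >= e^y (1 - y)], the drift inequality at the single point [theta]
   already bounds the exponential moment: no integration over [theta] is needed. *)
Lemma chernoff (R : realType) (T : finType) (S : {set T}) (f : T -> R) (c s theta : R) :
  0 <= theta -> \sum_(x in S) (f x - c) * expR (theta * f x) <= 0 ->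
  #|[set x in S | c + s <= f x]|%:R <= #|S|%:R * expR (- (theta * s)).
Proof.
move=> t0 drift.
have M : \sum_(x in S) expR (theta * (f x - c)) <= #|S|%:R.
  apply: (@le_trans _ _ (\sum_(x in S) (1 + theta * (f x - c) * expR (theta * (f x - c))))).
    apply: ler_sum => x _; set y := theta * _.
    have := expR_ge1Dx (- y); have := expRxMexpNx_1 y; have := expR_gt0 y; nra.
  rewrite big_split /= sumr_const gerDl.
  rewrite (_ : \sum_(i in S) _ =
     theta * expR (- (theta * c)) * \sum_(x in S) (f x - c) * expR (theta * f x)).
    by rewrite mulr_ge0_le0 // mulr_ge0 ?expR_ge0.
  rewrite mulr_sumr; apply: eq_bigr => x _.
  by rewrite mulrBr expRD; ring.
rewrite -ler_pdivrMr ?expR_gt0 // -expRN opprK.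
apply: le_trans M; rewrite -sum1_card natr_sum mulr_suml.
rewrite [leRHS](bigID (fun x => c + s <= f x)) /=.
apply: ler_wpDr; first by apply: sumr_ge0 => x _; exact: expR_ge0.
rewrite (eq_bigl (fun x => (x \in S) && (c + s <= f x))); last by move=> x; rewrite inE.
by apply: ler_sum => x /andP[_ fx]; rewrite mul1r ler_expR ler_wpM2l // lerBrDl.
Qed.

Section Switching.
Context (R : realType) (n m : nat).
Implicit Types (G : bigraph n m) (u a : 'I_n) (v b : 'I_m).

Definition edge G u v : R := ((u, v) \in G)%:R.

Lemma edge_ge0 G u v : 0 <= edge G u v.
Proof. exact: ler0n. Qed.

(** All four cells of the rectangle are toggled, so the map is an involution on all graphs with no
    side condition; where [switchable] holds it exchanges the edges [uv, u'v'] for [uv', u'v]. *)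
Definition switch u v u' v' G : bigraph n m :=
  [set e | (e \in G) (+) (((e.1 == u) || (e.1 == u')) && ((e.2 == v) || (e.2 == v')))].

Definition switchable G u v u' v' :=
  [&& (u, v) \in G, (u', v') \in G, (u, v') \notin G & (u', v) \notin G].

Lemma switchK u v u' v' : involutive (switch u v u' v').
Proof. by move=> G; apply/setP=> e; rewrite !inE -addbA addbb addbF. Qed.

Lemma switchable_switch G u v u' v' :
  switchable G u v u' v' -> switchable (switch u v u' v' G) u v' u' v.
Proof.
by case/and4P=> uv uv' nuv nuv'; rewrite /switchable !inE !eqxx !orbT /= uv uv'
  (negbTE nuv) (negbTE nuv').
Qed.

Lemma switchC u v u' v' : switch u v' u' v =1 switch u v u' v'.
Proof. by move=> G; apply/setP=> e; rewrite !inE [(e.2 == v') || _]orbC. Qed.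

Lemma edge_switch G u v u' v' a b : switchable G u v u' v' ->
  edge (switch u v u' v' G) a b = edge G a b
    - (a == u)%:R * (b == v)%:R - (a == u')%:R * (b == v')%:R
    + (a == u)%:R * (b == v')%:R + (a == u')%:R * (b == v)%:R.
Proof.
case/and4P=> uv uv' nuv nuv'.
(* Switchability by itself excludes degenerate rectangles, so the indicators of the four cells never
   overlap. *)
have uu' : u != u' by apply: contraNneq nuv => ->.
have vv' : v != v' by apply: contraNneq nuv => <-.
rewrite /edge inE /=.
case: (eqVneq a u) => [->|_]; last case: (eqVneq a u') => [->|_];
  (case: (eqVneq b v) => [->|_]; last case: (eqVneq b v') => [->|_]);
  rewrite ?uv ?uv' ?(negbTE nuv) ?(negbTE nuv') ?(negbTE uu') ?(negbTE vv') /= ?addbF;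
  ring.
Qed.

Lemma sum_eq1l (T : finType) (t0 : T) (F : T -> R) :
  \sum_t (t == t0)%:R * F t = F t0.
Proof.
rewrite (bigD1 t0) //= eqxx mul1r big1 ?addr0 // => t /negbTE ->.
by rewrite mul0r.
Qed.

Lemma ldegE G u : (ldeg G u)%:R = \sum_v edge G u v.
Proof.
rewrite /ldeg -sum1_card natr_sum big_mkcond; apply: eq_bigr => v _.
by rewrite inE /edge; case: ifP.
Qed.

Lemma rdegE G v : (rdeg G v)%:R = \sum_u edge G u v.
Proof.
rewrite /rdeg -sum1_card natr_sum big_mkcond; apply: eq_bigr => u _.
by rewrite inE /edge; case: ifP.
Qed.

Lemma sum_eq1 (T : finType) (t0 : T) : \sum_t (t == t0)%:R = 1 :> R.
Proof. by rewrite -[RHS](sum_eq1l _ t0 (fun=> 1)); apply: eq_bigr => t _; rewrite mulr1. Qed.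

Lemma ldeg_switch G u v u' v' a : switchable G u v u' v' ->
  ldeg (switch u v u' v' G) a = ldeg G a.
Proof.
move=> sG; apply/eqP; rewrite -(eqr_nat R) !ldegE.
under eq_bigr do rewrite edge_switch //.
rewrite !(big_split, sumrN) /= -!mulr_sumr !sum_eq1; apply/eqP; ring.
Qed.

Lemma rdeg_switch G u v u' v' b : switchable G u v u' v' ->
  rdeg (switch u v u' v' G) b = rdeg G b.
Proof.
move=> sG; apply/eqP; rewrite -(eqr_nat R) !rdegE.
under eq_bigr do rewrite edge_switch //.
rewrite !(big_split, sumrN) /= -!mulr_suml !sum_eq1; apply/eqP; ring.
Qed.

Context (d1 d2 : nat).
Local Notation Omega := (biregular n m d1 d2).

Lemma biregular_switch G u v u' v' : switchable G u v u' v' ->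
  (switch u v u' v' G \in Omega) = (G \in Omega).
Proof.
move=> sG; rewrite !inE; congr (_ && _); apply: eq_forallb => x.
  by rewrite ldeg_switch.
by rewrite rdeg_switch.
Qed.

(** Reversibility: [switch] preserves degrees and is a bijection between the graphs that admit a
    switching and those that admit the reverse one. *)
Lemma sum_switch u v u' v' (F : bigraph n m -> R) :
  \sum_(G in Omega | switchable G u v u' v') F G =
  \sum_(G in Omega | switchable G u v' u' v) F (switch u v' u' v G).
Proof.
rewrite (reindex_inj (inv_inj (switchK u v' u' v))); apply: eq_bigl => G.
apply/andP/andP => -[GO sG].
  have sG' : switchable G u v' u' v.
    by have := switchable_switch _ _ _ _ _ sG; rewrite -(switchC u v u' v') switchK.
  by rewrite -(biregular_switch _ _ _ _ _ sG').
by rewrite biregular_switch // GO switchable_switch.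
Qed.

Lemma row_sum G u : G \in Omega -> \sum_v edge G u v = d1%:R.
Proof. by rewrite inE => /andP[/forallP/(_ u)/eqP <- _]; rewrite ldegE. Qed.

Lemma col_sum G v : G \in Omega -> \sum_u edge G u v = d2%:R.
Proof. by rewrite inE => /andP[_ /forallP/(_ v)/eqP <-]; rewrite rdegE. Qed.

Definition estat (Q : 'I_n -> 'I_m -> R) G : R := \sum_u \sum_v Q u v * edge G u v.

(** The loss of [estat Q] under a switching, that is Delta up to sign. *)
Definition rdiff (Q : 'I_n -> 'I_m -> R) u v u' v' : R :=
  Q u v + Q u' v' - Q u v' - Q u' v.

Lemma estat_switch Q G u v u' v' : switchable G u v u' v' ->
  estat Q (switch u v u' v' G) = estat Q G - rdiff Q u v u' v'.
Proof.
move=> sG; rewrite /estat /rdiff.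
have E a b : Q a b * edge (switch u v u' v' G) a b = Q a b * edge G a b
    - (a == u)%:R * ((b == v)%:R * Q a b) - (a == u')%:R * ((b == v')%:R * Q a b)
    + (a == u)%:R * ((b == v')%:R * Q a b) + (a == u')%:R * ((b == v)%:R * Q a b).
  by rewrite edge_switch //; ring.
under eq_bigr => a _ do under eq_bigr => b _ do rewrite E.
under eq_bigr do rewrite !(big_split, sumrN) /= -!mulr_sumr !sum_eq1l.
by rewrite !(big_split, sumrN) /= !sum_eq1l; ring.
Qed.

(** The indicator of [switchable] as a polynomial in the edges, which can be expanded and summed by
    means of the degree conditions. *)
Definition switchr G u v u' v' : R :=
  edge G u v * edge G u' v' * (1 - edge G u v') * (1 - edge G u' v).

Lemma switchrE G u v u' v' : switchr G u v u' v' = (switchable G u v u' v')%:R.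
Proof.
rewrite /switchr /switchable /edge.
by do 4![case: (_ \in G)]; rewrite /= ?(subrr, subr0, mulr0, mul0r, mulr1).
Qed.

Lemma switchr_ge0 G u v u' v' : 0 <= switchr G u v u' v'.
Proof. by rewrite switchrE ler0n. Qed.

Lemma switchr_le G u v u' v' : switchr G u v u' v' <= edge G u v * edge G u' v'.
Proof.
rewrite /switchr /edge.
by do 4![case: (_ \in G)]; rewrite /= ?(subrr, subr0, mulr0, mul0r, mulr1).
Qed.

(** From [(1 - a) (1 - b) >= 1 - a - b]; the two subtracted products are paths of three edges. *)
Lemma switchr_ge G u v u' v' :
  edge G u v * edge G u' v'
  - edge G u v * edge G u' v' * edge G u v'
  - edge G u v * edge G u' v' * edge G u' v <= switchr G u v u' v'.
Proof. by rewrite /switchr /edge; do 4![case: (_ \in G)]; rewrite /=; lra. Qed.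

Lemma sum_switchr u v u' v' (F : bigraph n m -> R) :
  \sum_(G in Omega) switchr G u v u' v' * F G =
  \sum_(G in Omega) switchr G u v' u' v * F (switch u v' u' v G).
Proof.
have E a b c d (H : bigraph n m -> R) : \sum_(G in Omega) switchr G a b c d * H G
    = \sum_(G in Omega | switchable G a b c d) H G.
  rewrite big_mkcondr; apply: eq_bigr => G _; rewrite switchrE.
  by case: ifP; rewrite ?mul1r ?mul0r.
by rewrite !E sum_switch.
Qed.

(** * Exponential moments and the tilted density of a single edge *)

Definition mgf Q (theta : R) : R := \sum_(G in Omega) expR (theta * estat Q G).

Lemma rdiff_le Q (c : R) u v u' v' :
  (forall a b, `|Q a b| <= c) -> `|rdiff Q u v u' v'| <= 4 * c.
Proof.
move=> Qc; move: (Qc u v) (Qc u' v') (Qc u v') (Qc u' v).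
by rewrite /rdiff !ler_norml => /andP[? ?] /andP[? ?] /andP[? ?] /andP[? ?];
  apply/andP; split; lra.
Qed.

Lemma row_sum2 G (F : 'I_n -> R) : G \in Omega ->
  \sum_u \sum_v F u * edge G u v = d1%:R * \sum_u F u.
Proof.
move=> GO; rewrite mulr_sumr; apply: eq_bigr => u _.
by rewrite -mulr_sumr row_sum // mulrC.
Qed.

Lemma col_sum2 G (F : 'I_m -> R) : G \in Omega ->
  \sum_u \sum_v F v * edge G u v = d2%:R * \sum_v F v.
Proof.
move=> GO; rewrite exchange_big mulr_sumr; apply: eq_bigr => v _.
by rewrite -mulr_sumr col_sum // mulrC.
Qed.

Hypothesis (n_gt0 : (0 < n)%N) (d1_gt0 : (0 < d1)%N) (edges : (n * d1 = m * d2)%N).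
Hypothesis d2_small : (4 * d2 <= n)%N.
Local Notation p := (d2%:R / n%:R : R).

Lemma expR_estat_switch Q (c theta : R) G u v u' v' : 0 <= theta ->
  (forall a b, `|Q a b| <= c) -> switchable G u v u' v' ->
  expR (theta * estat Q (switch u v u' v' G)) <=
    expR (4 * c * theta) * expR (theta * estat Q G).
Proof.
move=> t0 Qc sG; rewrite estat_switch // -expRD ler_expR.
have := rdiff_le Q c u v u' v' Qc; rewrite ler_norml => /andP[h _].
by rewrite mulrBr; nra.
Qed.

(** Double counting of switchings: an edge [uv] can be switched with at least half of the [n d1]
    edges, while the reverse switching only chooses an edge at [u] and an edge at [v], in [d1 d2]
    ways. Each switching changes the weight by a factor of at most [e^(4 c theta)]. This is the a
    priori density of an edge under the tilted law. *)
Lemma mgf_edge Q (c theta : R) u v : 0 <= theta -> (forall a b, `|Q a b| <= c) ->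
  \sum_(G in Omega) edge G u v * expR (theta * estat Q G)
    <= 2 * p * expR (4 * c * theta) * mgf Q theta.
Proof.
move=> t0 Qc; set W := fun G => expR (theta * estat Q G).
have n0 : 0 < n%:R :> R by rewrite ltr0n.
have d0 : 0 < d1%:R :> R by rewrite ltr0n.
have dn : 4 * d2%:R <= n%:R :> R by rewrite -natrM ler_nat.
(* At most [2 d1 d2] pairs are forbidden by a third edge, and [4 d2 <= n] keeps this below half of
   [n d1]. *)
have lower G : G \in Omega -> n%:R * d1%:R / 2 * edge G u v <=
    \sum_u' \sum_v' switchr G u v u' v'.
  move=> GO.
  apply: (@le_trans _ _ (\sum_u' \sum_v' (edge G u v * edge G u' v'
      - edge G u v * edge G u' v' * edge G u v'
      - edge G u v * edge G u' v' * edge G u' v))); last first.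
    by apply: ler_sum => u' _; apply: ler_sum => v' _; exact: switchr_ge.
  have -> : \sum_u' \sum_v' (edge G u v * edge G u' v'
      - edge G u v * edge G u' v' * edge G u v'
      - edge G u v * edge G u' v' * edge G u' v) =
     edge G u v * (\sum_u' \sum_v' 1 * edge G u' v'
       - \sum_u' \sum_v' edge G u v' * edge G u' v'
       - \sum_u' \sum_v' edge G u' v * edge G u' v').
    rewrite -!sumrB mulr_sumr; apply: eq_bigr => u' _.
    rewrite -!sumrB mulr_sumr; apply: eq_bigr => v' _; ring.
  rewrite row_sum2 // col_sum2 // row_sum2 // row_sum // col_sum //.
  rewrite sumr_const card_ord -[n%:R in leRHS]mulr_natl mulr1.
  rewrite mulrC ler_wpM2l ?edge_ge0 //; nra.
have key : n%:R * d1%:R / 2 * \sum_(G in Omega) edge G u v * W G <=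
    d1%:R * d2%:R * expR (4 * c * theta) * mgf Q theta.
  rewrite mulr_sumr.
  apply: (@le_trans _ _ (\sum_(G in Omega) \sum_u' \sum_v' switchr G u v u' v' * W G)).
    apply: ler_sum => G GO; rewrite mulrA.
    under eq_bigr do rewrite -mulr_suml.
    by rewrite -mulr_suml ler_wpM2r ?expR_ge0 // lower.
  rewrite exchange_big /=; under eq_bigr do rewrite exchange_big /=.
  apply: (@le_trans _ _ (\sum_u' \sum_v' \sum_(G in Omega)
      expR (4 * c * theta) * (edge G u v' * edge G u' v * W G))).
    apply: ler_sum => u' _; apply: ler_sum => v' _; rewrite sum_switchr.
    apply: ler_sum => G _; rewrite switchrE.
    case: (boolP (switchable _ _ _ _ _)) => [sG|_]; last first.
      by rewrite mul0r !mulr_ge0 ?expR_ge0 ?edge_ge0.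
    have /and4P[e1 e2 _ _] := sG.
    by rewrite /edge e1 e2 !mul1r; exact: expR_estat_switch.
  under eq_bigr do rewrite exchange_big /=.
  rewrite exchange_big /= /mgf mulr_sumr; apply: ler_sum => G GO.
  have -> : \sum_u' \sum_v' expR (4 * c * theta) * (edge G u v' * edge G u' v * W G)
     = (\sum_u' edge G u' v) * (\sum_v' edge G u v') * (expR (4 * c * theta) * W G).
    rewrite !mulr_suml; apply: eq_bigr => u' _.
    rewrite mulr_sumr mulr_suml; apply: eq_bigr => v' _; ring.
  by rewrite row_sum // col_sum // (mulrC d2%:R) mulrA.
have nd0 : 0 < n%:R * d1%:R / 2 :> R by rewrite divr_gt0 ?mulr_gt0.
rewrite -(ler_pM2l nd0); apply: le_trans key _.
rewrite (_ : _ / 2 * _ = d1%:R * d2%:R * expR (4 * c * theta) * mgf Q theta) //.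
by field; rewrite gt_eqF.
Qed.

(** * Sums over ordered pairs of edges *)

Lemma quad_swap (F : 'I_n -> 'I_m -> 'I_n -> 'I_m -> R) :
  \sum_u \sum_v \sum_u' \sum_v' F u v u' v' = \sum_u \sum_v \sum_u' \sum_v' F u' v' u v.
Proof.
have E (H : 'I_n -> 'I_m -> 'I_n -> 'I_m -> R) :
    \sum_u \sum_v \sum_u' \sum_v' H u v u' v' = \sum_e \sum_e' H e.1 e.2 e'.1 e'.2.
  by rewrite pair_bigA; apply: eq_bigr => e _; rewrite pair_bigA.
by rewrite E (E (fun u v u' v' => F u' v' u v)) exchange_big.
Qed.

Lemma quad_swapr (F : 'I_n -> 'I_m -> 'I_n -> 'I_m -> R) :
  \sum_u \sum_v \sum_u' \sum_v' F u v u' v' = \sum_u \sum_v \sum_u' \sum_v' F u v' u' v.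
Proof.
apply: eq_bigr => u _; rewrite exchange_big [RHS]exchange_big.
by apply: eq_bigr => u' _; rewrite exchange_big.
Qed.

Lemma sum_edges G : G \in Omega -> \sum_u \sum_v edge G u v = n%:R * d1%:R.
Proof.
move=> GO; under eq_bigr do rewrite row_sum //.
by rewrite sumr_const card_ord -[LHS]mulr_natl.
Qed.

Lemma edge_pairs_diag F G : G \in Omega ->
  \sum_u \sum_v \sum_u' \sum_v' edge G u v * edge G u' v' * F u v =
  n%:R * d1%:R * estat F G.
Proof.
move=> GO; rewrite -(sum_edges G GO) mulr_sumr; apply: eq_bigr => u _.
rewrite mulr_sumr; apply: eq_bigr => v _.
rewrite !mulr_suml; apply: eq_bigr => u' _.
rewrite !mulr_suml; apply: eq_bigr => v' _; ring.
Qed.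

Lemma edge_pairs_cross (F : 'I_n -> 'I_m -> R) G : G \in Omega ->
  \sum_u \sum_v \sum_u' \sum_v' edge G u v * edge G u' v' * F u v' =
  d1%:R * d2%:R * \sum_u \sum_v F u v.
Proof.
move=> GO; rewrite mulr_sumr; apply: eq_bigr => u _.
rewrite mulr_sumr exchange_big /=.
under eq_bigr do rewrite exchange_big /=.
rewrite exchange_big /=; apply: eq_bigr => v' _.
rewrite -(row_sum G u GO) -(col_sum G v' GO) mulrC mulr_sumr mulr_sumr.
apply: eq_bigr => u' _; rewrite mulr_suml mulr_sumr.
by apply: eq_bigr => v _; ring.
Qed.

(** By regularity a left vertex occupies each of the two left positions in [d1^2 d2] walks
    [v u v' u'], and a right vertex each of the two right positions in [d1 d2^2] of them. *)
Lemma paths3 (xi : 'I_n -> R) (eta : 'I_m -> R) G : G \in Omega ->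
  \sum_u \sum_v \sum_u' \sum_v' edge G u v * edge G u' v' * edge G u v' *
     (xi u + xi u' + eta v + eta v') =
  2 * d1%:R * d2%:R * (d1%:R * \sum_u xi u + d2%:R * \sum_v eta v).
Proof.
move=> GO.
pose e := edge G.
(* Each of the four sums is nested outwards from its weighted vertex, so that every inner sum is a
   full row or column. *)
have -> : \sum_u \sum_v \sum_u' \sum_v' edge G u v * edge G u' v' * edge G u v' *
     (xi u + xi u' + eta v + eta v') =
  \sum_u xi u * ((\sum_v e u v) * \sum_v' e u v' * (\sum_u' e u' v'))
  + \sum_u' xi u' * (\sum_v' e u' v' * (\sum_u e u v' * (\sum_v e u v)))
  + \sum_v eta v * (\sum_u e u v * (\sum_v' e u v' * (\sum_u' e u' v')))
  + \sum_v eta v * (\sum_u e u v * ((\sum_u' e u' v) * (\sum_v' e u v'))).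
  have -> : \sum_u xi u * ((\sum_v e u v) * \sum_v' e u v' * (\sum_u' e u' v')) =
      \sum_u \sum_v \sum_u' \sum_v' edge G u v * edge G u' v' * edge G u v' * xi u.
    apply: eq_bigr => u _; rewrite mulr_suml mulr_sumr; apply: eq_bigr => v _.
    rewrite exchange_big !mulr_sumr; apply: eq_bigr => v' _.
    rewrite !mulr_sumr; apply: eq_bigr => u' _; rewrite /e; ring.
  have -> : \sum_u' xi u' * (\sum_v' e u' v' * (\sum_u e u v' * (\sum_v e u v))) =
      \sum_u \sum_v \sum_u' \sum_v' edge G u v * edge G u' v' * edge G u v' * xi u'.
    under [RHS]eq_bigr do rewrite exchange_big /=.
    rewrite [RHS]exchange_big; apply: eq_bigr => u' _.
    under [RHS]eq_bigr do rewrite exchange_big /=.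
    rewrite [RHS]exchange_big mulr_sumr; apply: eq_bigr => v' _.
    rewrite !mulr_sumr; apply: eq_bigr => u _.
    rewrite !mulr_sumr; apply: eq_bigr => v _; rewrite /e; ring.
  have -> : \sum_v eta v * (\sum_u e u v * (\sum_v' e u v' * (\sum_u' e u' v'))) =
      \sum_u \sum_v \sum_u' \sum_v' edge G u v * edge G u' v' * edge G u v' * eta v.
    rewrite [RHS]exchange_big; apply: eq_bigr => v _.
    rewrite mulr_sumr; apply: eq_bigr => u _.
    rewrite exchange_big !mulr_sumr; apply: eq_bigr => v' _.
    rewrite !mulr_sumr; apply: eq_bigr => u' _; rewrite /e; ring.
  have -> : \sum_v eta v * (\sum_u e u v * ((\sum_u' e u' v) * (\sum_v' e u v'))) =
      \sum_u \sum_v \sum_u' \sum_v' edge G u v * edge G u' v' * edge G u v' * eta v'.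
    rewrite [RHS]quad_swapr [RHS]exchange_big; apply: eq_bigr => v _.
    rewrite mulr_sumr; apply: eq_bigr => u _.
    rewrite mulr_suml !mulr_sumr; apply: eq_bigr => u' _.
    rewrite !mulr_sumr; apply: eq_bigr => v' _; rewrite /e; ring.
  rewrite -!big_split /=; apply: eq_bigr => u _.
  rewrite -!big_split /=; apply: eq_bigr => v _.
  rewrite -!big_split /=; apply: eq_bigr => u' _.
  rewrite -!big_split /=; apply: eq_bigr => v' _; ring.
have row u : \sum_v e u v = d1%:R by rewrite row_sum.
have col v : \sum_u e u v = d2%:R by rewrite col_sum.
have c1 u : \sum_v' e u v' * (\sum_u' e u' v') = d1%:R * d2%:R.
  by under eq_bigr do rewrite col; rewrite -mulr_suml row.
have c2 v : \sum_u e u v * (\sum_v' e u v') = d2%:R * d1%:R.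
  by under eq_bigr do rewrite row; rewrite -mulr_suml col.
have c3 u : \sum_v' e u v' * (\sum_u e u v' * (\sum_v e u v)) = d1%:R * (d2%:R * d1%:R).
  by under eq_bigr do rewrite c2; rewrite -mulr_suml row.
have c4 v : \sum_u e u v * (\sum_v' e u v' * (\sum_u' e u' v')) = d2%:R * (d1%:R * d2%:R).
  by under eq_bigr do rewrite c1; rewrite -mulr_suml col.
have c5 v : \sum_u e u v * ((\sum_u' e u' v) * (\sum_v' e u v')) = d2%:R * (d2%:R * d1%:R).
  by under eq_bigr do rewrite col row; rewrite -mulr_suml col.
under eq_bigr do rewrite row c1.
under [X in _ + X + _ + _]eq_bigr do rewrite c3.
under [X in _ + _ + X + _]eq_bigr do rewrite c4.
under [X in _ + _ + _ + X]eq_bigr do rewrite c5.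
by rewrite -!mulr_suml; ring.
Qed.

(** The parameter serves two uses: [s = -1] makes the summand [rdiff] and gives the drift, [s = 1]
    gives the sum of squares in [switch_energy]. *)
Lemma edge_pairs (s : R) F G : G \in Omega ->
  \sum_u \sum_v \sum_u' \sum_v' edge G u v * edge G u' v' *
     (F u v + F u' v' + s * (F u v' + F u' v)) =
  2 * (n%:R * d1%:R) * estat F G + s * (2 * (d1%:R * d2%:R) * \sum_u \sum_v F u v).
Proof.
move=> GO.
have D1 := edge_pairs_diag F G GO; have C1 := edge_pairs_cross F G GO.
pose e := edge G.
transitivity (\sum_u \sum_v \sum_u' \sum_v' e u v * e u' v' * F u v
  + \sum_u \sum_v \sum_u' \sum_v' e u' v' * e u v * F u' v'
  + s * (\sum_u \sum_v \sum_u' \sum_v' e u v * e u' v' * F u v'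
  + \sum_u \sum_v \sum_u' \sum_v' e u' v' * e u v * F u' v)); first last.
  rewrite -[X in _ + X + _]quad_swap -[X in _ * (_ + X)]quad_swap D1 C1.
  by set S := \sum_u _; ring.
rewrite -!big_split mulr_sumr -big_split /=.
apply: eq_bigr => u _; rewrite -!big_split mulr_sumr -big_split /=.
apply: eq_bigr => v _; rewrite -!big_split mulr_sumr -big_split /=.
apply: eq_bigr => u' _; rewrite -!big_split mulr_sumr -big_split /=.
apply: eq_bigr => v' _; rewrite /e; ring.
Qed.

(* The forbidden pairs of edges are those joined by a third edge; they are counted
   by [paths3], with [xi u + xi u' + eta v + eta v'] dominating the increment. *)
Lemma switch_drift Q (xi : 'I_n -> R) (eta : 'I_m -> R) G : G \in Omega ->
  (forall u v, `|Q u v| <= (xi u + eta v) / 2) ->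
  \sum_u xi u <= 16 * n%:R -> \sum_v eta v <= 16 * m%:R ->
  2 * (n%:R * d1%:R) * estat Q G - 2 * (d1%:R * d2%:R) * (\sum_u \sum_v Q u v) <=
  \sum_u \sum_v \sum_u' \sum_v' switchr G u v u' v' * rdiff Q u v u' v'
  + 128 * (n%:R * d1%:R) * (d1%:R * d2%:R).
Proof.
move=> GO Qle xile etale; pose e := edge G.
have nd : n%:R * d1%:R = m%:R * d2%:R :> R by rewrite -!natrM edges.
have := edge_pairs (-1) Q G GO; rewrite mulN1r => <-.
pose s u v u' v' := xi u + xi u' + eta v + eta v'.
have rd u v u' v' : rdiff Q u v u' v' <= s u v u' v'.
  move: (Qle u v) (Qle u' v') (Qle u v') (Qle u' v).
  rewrite /rdiff /s !ler_norml => /andP[? ?] /andP[? ?] /andP[? ?] /andP[? ?]; lra.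
have rdN u v u' v' : 0 <= s u v u' v'.
  move: (le_trans (normr_ge0 _) (Qle u v)) (le_trans (normr_ge0 _) (Qle u' v')).
  rewrite /s; lra.
apply: (@le_trans _ _ (\sum_u \sum_v \sum_u' \sum_v'
   (switchr G u v u' v' * rdiff Q u v u' v' + (e u v * e u' v' * e u v' * s u v u' v' +
      e u v * e u' v' * e u' v * s u v u' v')))).
  apply: ler_sum => u _; apply: ler_sum => v _; apply: ler_sum => u' _; apply: ler_sum => v' _.
  rewrite -mulrDl -lerBlDl.
  rewrite (_ : _ + -1 * _ = rdiff Q u v u' v'); last by rewrite /rdiff; ring.
  rewrite -mulrBl.
  have := switchr_ge G u v u' v'; have := switchr_le G u v u' v'.
  move: (rd u v u' v') (rdN u v u' v'); rewrite -/e.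
  set x := rdiff _ _ _ _ _; set y := s _ _ _ _; move=> xy y0 h1 h2.
  apply: (@le_trans _ _ ((e u v * e u' v' - switchr G u v u' v') * y)).
    by rewrite ler_wpM2l // subr_ge0.
  by rewrite ler_wpM2r //; lra.
have -> (F H : 'I_n -> 'I_m -> 'I_n -> 'I_m -> R) : \sum_u \sum_v \sum_u' \sum_v' (F u v u' v' + H u v u' v')
   = \sum_u \sum_v \sum_u' \sum_v' F u v u' v' + \sum_u \sum_v \sum_u' \sum_v' H u v u' v'.
  rewrite -big_split; apply: eq_bigr => u _; rewrite -big_split; apply: eq_bigr => v _.
  by rewrite -big_split; apply: eq_bigr => u' _; rewrite -big_split.
rewrite lerD2l.
have -> : \sum_u \sum_v \sum_u' \sum_v'
   (e u v * e u' v' * e u v' * s u v u' v' + e u v * e u' v' * e u' v * s u v u' v') =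
   2 * \sum_u \sum_v \sum_u' \sum_v' e u v * e u' v' * e u v' * s u v u' v'.
  rewrite mulr_natl mulr2n [X in _ = X + _]quad_swap -!big_split; apply: eq_bigr => u _.
  rewrite -!big_split; apply: eq_bigr => v _; rewrite -!big_split; apply: eq_bigr => u' _.
  rewrite -!big_split; apply: eq_bigr => v' _; rewrite /s /=; ring.
rewrite paths3 //.
have D1 : 0 <= d1%:R :> R by []. have D2 : 0 <= d2%:R :> R by [].
(* Since [n d1 = m d2], each of the two terms is at most [16 n d1]. The two kinds of paths then cost
   [4 d1 d2 * 32 n d1], whence the constant 128. *)
have h : d1%:R * \sum_u xi u + d2%:R * \sum_v eta v <= 32 * (n%:R * d1%:R).
  have := ler_wpM2l D1 xile; have := ler_wpM2l D2 etale; nra.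
have := ler_wpM2l (mulr_ge0 D1 D2) h; nra.
Qed.

(** The increment of the exponential is at most [theta |x|] times its value at the larger endpoint,
    and that value is at most [e^(c theta)] times the one at [y], whatever the sign of [x]. *)
Lemma expR_diff_le (x y c theta : R) : 0 <= theta -> `|x| <= c ->
  x * (expR (theta * y) - expR (theta * (y - x))) <=
  theta * expR (c * theta) * (x ^+ 2 * expR (theta * y)).
Proof.
move=> t0 xc; have [x0|x0] := leP 0 x.
  have h1 : 1 <= expR (c * theta).
    by rewrite -expR0 ler_expR mulr_ge0 // (le_trans _ xc).
  have h2 : expR (theta * y) - expR (theta * (y - x)) <= theta * x * expR (theta * y).
    have -> : theta * (y - x) = theta * y + - (theta * x) by ring.
    rewrite expRD; have := expR_ge1Dx (- (theta * x)); have := expR_gt0 (theta * y); nra.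
  apply: (@le_trans _ _ (x * (theta * x * expR (theta * y)))); first by rewrite ler_wpM2l.
  rewrite (_ : _ * expR (c * theta) * _ =
    x * (theta * x * expR (theta * y)) * expR (c * theta)); last by ring.
  by rewrite ler_peMr // !mulr_ge0 ?expR_ge0.
have -> : theta * (y - x) = theta * y + - (theta * x) by ring.
rewrite expRD; set h := expR (- (theta * x)).
have hc : h <= expR (c * theta).
  rewrite ler_expR; move: xc; rewrite ler_norml => /andP[? _]; nra.
have h1 : h - 1 <= - (theta * x) * h.
  have := expR_ge1Dx (theta * x); have := expRxMexpNx_1 (theta * x); rewrite -/h.
  have : 0 < h by exact: expR_gt0.
  nra.
rewrite (_ : x * _ = expR (theta * y) * ((- x) * (h - 1))); last by ring.
rewrite (_ : _ * (x ^+ 2 * _) = expR (theta * y) * (theta * expR (c * theta) * x ^+ 2));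
  last by ring.
rewrite ler_wpM2l ?expR_ge0 //.
apply: (@le_trans _ _ ((- x) * (- (theta * x) * h))).
  by rewrite ler_wpM2l // oppr_ge0 ltW.
rewrite (_ : _ * (_ * h) = theta * x ^+ 2 * h); last by ring.
by rewrite mulrAC ler_wpM2r ?sqr_ge0 // ler_wpM2l.
Qed.

(** Reversing a switching changes the sign of [rdiff]. Adding the sum to its reversed form therefore
    leaves differences of exponentials, which [expR_diff_le] makes quadratic in [rdiff]. *)
Lemma mgf_dissipation Q (c theta : R) : 0 <= theta -> (forall u v, `|Q u v| <= c) ->
  \sum_(G in Omega) (\sum_u \sum_v \sum_u' \sum_v'
      switchr G u v u' v' * rdiff Q u v u' v') * expR (theta * estat Q G) <=
  theta * expR (4 * c * theta) / 2 *
  \sum_(G in Omega) (\sum_u \sum_v \sum_u' \sum_v'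
      switchr G u v u' v' * rdiff Q u v u' v' ^+ 2) * expR (theta * estat Q G).
Proof.
move=> t0 Qc; pose W G := expR (theta * estat Q G).
have flat (F : bigraph n m -> 'I_n -> 'I_m -> 'I_n -> 'I_m -> R) :
    \sum_(G in Omega) (\sum_u \sum_v \sum_u' \sum_v' F G u v u' v') * W G =
    \sum_u \sum_v \sum_u' \sum_v' \sum_(G in Omega) F G u v u' v' * W G.
  under eq_bigr do rewrite mulr_suml; rewrite exchange_big; apply: eq_bigr => u _.
  under eq_bigr do rewrite mulr_suml; rewrite exchange_big; apply: eq_bigr => v _.
  under eq_bigr do rewrite mulr_suml; rewrite exchange_big; apply: eq_bigr => u' _.
  by under eq_bigr do rewrite mulr_suml; rewrite exchange_big.
rewrite -[leLHS]/(\sum_(G in Omega) _ * W G) -[X in _ <= _ * X]/(\sum_(G in Omega) _ * W G).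
rewrite !flat.
set Z := leLHS.
(* Pairing each switching with its reverse. *)
have ZE : Z = \sum_u \sum_v \sum_u' \sum_v' \sum_(G in Omega)
    switchr G u v u' v' * (- rdiff Q u v u' v' * W (switch u v u' v' G)).
  rewrite /Z quad_swapr; apply: eq_bigr => u _; apply: eq_bigr => v _.
  apply: eq_bigr => u' _; apply: eq_bigr => v' _.
  under eq_bigr do rewrite -mulrA.
  rewrite sum_switchr; apply: eq_bigr => G _; congr (_ * (_ * _)).
    by rewrite /rdiff; ring.
  by rewrite -(switchC u v u' v') switchK.
have : Z + Z <= theta * expR (4 * c * theta) * \sum_u \sum_v \sum_u' \sum_v'
    \sum_(G in Omega) switchr G u v u' v' * rdiff Q u v u' v' ^+ 2 * W G.
  rewrite [X in _ + X]ZE /Z -big_split mulr_sumr; apply: ler_sum => u _.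
  rewrite -big_split mulr_sumr; apply: ler_sum => v _.
  rewrite -big_split mulr_sumr; apply: ler_sum => u' _.
  rewrite -big_split mulr_sumr; apply: ler_sum => v' _.
  rewrite -big_split mulr_sumr; apply: ler_sum => G _ /=.
  rewrite switchrE; case: (boolP (switchable _ _ _ _ _)) => [sG|_]; last first.
    by rewrite !mul0r mulr0 addr0.
  rewrite !mul1r mulNr -mulrBr /W estat_switch //.
  by apply: expR_diff_le => //; exact: rdiff_le.
by set S := \sum_u _; lra.
Qed.

(** The factor [1 *] gives the right-hand side the shape of [edge_pairs] at [s = 1]. *)
Lemma sqr4_le (a b c d : R) :
  (a + b - c - d) ^+ 2 <= 4 * (a ^+ 2 + b ^+ 2 + 1 * (c ^+ 2 + d ^+ 2)).
Proof.
have := sqr_ge0 (a - b); have := sqr_ge0 (a + c); have := sqr_ge0 (a + d).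
have := sqr_ge0 (b + c); have := sqr_ge0 (b + d); have := sqr_ge0 (c - d).
by nra.
Qed.

Lemma switch_energy Q G : G \in Omega ->
  \sum_u \sum_v \sum_u' \sum_v' switchr G u v u' v' * rdiff Q u v u' v' ^+ 2 <=
  8 * (n%:R * d1%:R) * estat (fun u v => Q u v ^+ 2) G +
  8 * (d1%:R * d2%:R) * \sum_u \sum_v Q u v ^+ 2.
Proof.
move=> GO; have := edge_pairs 1 (fun u v => Q u v ^+ 2) G GO.
set E := estat _ _; set S := \sum_u \sum_v Q u v ^+ 2 => H.
rewrite [leRHS](_ : _ = 4 * (2 * (n%:R * d1%:R) * E + 1 * (2 * (d1%:R * d2%:R) * S))); last by ring.
rewrite -H mulr_sumr; apply: ler_sum => u _; rewrite mulr_sumr; apply: ler_sum => v _.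
rewrite mulr_sumr; apply: ler_sum => u' _; rewrite mulr_sumr; apply: ler_sum => v' _.
rewrite [leRHS]mulrCA; apply: ler_pM => //; first exact: switchr_ge0.
- exact: sqr_ge0.
- exact: switchr_le.
exact: sqr4_le.
Qed.

Lemma prod_sum_le (xi : 'I_n -> R) (eta : 'I_m -> R) :
  (forall u, 0 <= xi u) -> (forall v, 0 <= eta v) ->
  \sum_u xi u <= 16 * n%:R -> \sum_v eta v <= 16 * m%:R ->
  \sum_u \sum_v xi u * eta v <= 256 * (n%:R * m%:R).
Proof.
move=> xi0 eta0 xile etale; under eq_bigr do rewrite -mulr_sumr.
rewrite -mulr_suml [leRHS](_ : _ = 16 * n%:R * (16 * m%:R)); last by ring.
by apply: ler_pM; rewrite ?sumr_ge0.
Qed.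

(** [switch_drift] bounds the centred statistic by the sum over switchings; [mgf_dissipation] and
    [switch_energy] bound that sum by squares of [Q] on edges, whose tilted mean comes from
    [mgf_edge]. The exponential is named [h] so that the caller can supply a simplified form of
    it. *)
Lemma mgf_drift Q (xi : 'I_n -> R) (eta : 'I_m -> R) (c theta : R) : 0 <= theta ->
  (forall u v, `|Q u v| <= c) ->
  (forall u, 0 <= xi u) -> (forall v, 0 <= eta v) ->
  (forall u v, Q u v ^+ 2 <= xi u * eta v) ->
  \sum_u xi u <= 16 * n%:R -> \sum_v eta v <= 16 * m%:R ->
  forall h, h = expR (4 * c * theta) ->
  \sum_(G in Omega) (estat Q G - (p * (\sum_u \sum_v Q u v) + 64 * (d1%:R * d2%:R)
     + 256 * theta * h * (4 * h + 2) * (m%:R * d2%:R))) * expR (theta * estat Q G) <= 0.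
Proof.
move=> t0 Qc xi0 eta0 Qxe xile etale h hE.
have h0 : 0 <= h by rewrite hE expR_ge0.
have n0 : 0 < n%:R :> R by rewrite ltr0n.
have d0 : 0 < d1%:R :> R by rewrite ltr0n.
have nd : n%:R * d1%:R = m%:R * d2%:R :> R by rewrite -!natrM edges.
(* AM-GM turns the product bound, suited to the energy, into the additive bound needed to count
   paths. *)
have Qle u v : `|Q u v| <= (xi u + eta v) / 2.
  have s0 : 0 <= (xi u + eta v) / 2 by rewrite divr_ge0 // addr_ge0.
  rewrite -(ler_pXn2r (n := 2)) ?nnegrE // -normrX ger0_norm ?sqr_ge0 //.
  apply: le_trans (Qxe u v) _; have := sqr_ge0 (xi u - eta v); nra.
set S := \sum_u \sum_v Q u v; set S2 := \sum_u \sum_v Q u v ^+ 2.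
have S2le : S2 <= 256 * (n%:R * m%:R).
  apply: le_trans (prod_sum_le _ _ xi0 eta0 xile etale).
  by apply: ler_sum => u _; apply: ler_sum.
pose W G := expR (theta * estat Q G).
have W0 G : 0 <= W G by exact: expR_ge0.
pose Z := \sum_(G in Omega) (\sum_u \sum_v \sum_u' \sum_v'
      switchr G u v u' v' * rdiff Q u v u' v') * W G.
have H1 : \sum_(G in Omega) (2 * (n%:R * d1%:R) * estat Q G - 2 * (d1%:R * d2%:R) * S
    - 128 * (n%:R * d1%:R) * (d1%:R * d2%:R)) * W G <= Z.
  apply: ler_sum => G GO; rewrite ler_wpM2r // lerBlDr.
  exact: (switch_drift Q xi eta).
have A3 : \sum_(G in Omega) estat (fun u v => Q u v ^+ 2) G * W G <= S2 * (2 * p * h * mgf Q theta).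
  rewrite /estat /S2; under eq_bigr do rewrite mulr_suml.
  rewrite exchange_big mulr_suml; apply: ler_sum => u _ /=; under eq_bigr do rewrite mulr_suml.
  rewrite exchange_big mulr_suml; apply: ler_sum => v _ /=.
  under eq_bigr do rewrite -mulrA; rewrite -mulr_sumr.
  by rewrite hE ler_wpM2l ?sqr_ge0 //; exact: mgf_edge.
have H2 : Z <= theta * h / 2 * (8 * (n%:R * d1%:R) * (2 * p * h * S2) +
   8 * (d1%:R * d2%:R) * S2) * mgf Q theta.
  apply: le_trans (mgf_dissipation Q c theta t0 Qc) _; rewrite -hE -[leRHS]mulrA.
  rewrite ler_wpM2l ?divr_ge0 ?mulr_ge0 //.
  apply: (@le_trans _ _ (\sum_(G in Omega) (8 * (n%:R * d1%:R) * estat (fun u v => Q u v ^+ 2) G +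
      8 * (d1%:R * d2%:R) * S2) * W G)).
    by apply: ler_sum => G GO; rewrite ler_wpM2r ?expR_ge0 // switch_energy.
  have -> : \sum_(G in Omega) (8 * (n%:R * d1%:R) * estat (fun u v => Q u v ^+ 2) G +
      8 * (d1%:R * d2%:R) * S2) * W G = 8 * (n%:R * d1%:R) *
     (\sum_(G in Omega) estat (fun u v => Q u v ^+ 2) G * W G) + 8 * (d1%:R * d2%:R) * S2 * mgf Q theta.
    by rewrite /mgf !mulr_sumr -big_split; apply: eq_bigr => G _; rewrite /= /W; ring.
  rewrite [leRHS]mulrDl lerD2r -[leRHS]mulrA ler_wpM2l ?mulr_ge0 //.
  by apply: le_trans A3 _; rewrite le_eqVlt; apply/orP; left; apply/eqP; ring.
have M0 : 0 <= mgf Q theta by apply: sumr_ge0 => G _; exact: expR_ge0.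
have nd0 : 0 < 2 * (n%:R * d1%:R) :> R by rewrite !mulr_gt0.
rewrite -(ler_pM2l nd0) mulr0.
have -> : 2 * (n%:R * d1%:R) * (\sum_(G in Omega) (estat Q G - (p * S + 64 * (d1%:R * d2%:R)
     + 256 * theta * h * (4 * h + 2) * (m%:R * d2%:R))) * expR (theta * estat Q G)) =
  \sum_(G in Omega) (2 * (n%:R * d1%:R) * estat Q G - 2 * (d1%:R * d2%:R) * S
    - 128 * (n%:R * d1%:R) * (d1%:R * d2%:R)) * W G -
  theta * h * (8 * h + 4) * (d1%:R * d2%:R) * (256 * (n%:R * m%:R)) * mgf Q theta.
  clearbody S; rewrite /mgf !mulr_sumr -sumrB; apply: eq_bigr => G _; rewrite -/(W G).
  by field; rewrite gt_eqF.
rewrite subr_le0; apply: le_trans H1 (le_trans H2 _); rewrite ler_wpM2r //.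
have -> : theta * h / 2 * (8 * (n%:R * d1%:R) * (2 * p * h * S2) + 8 * (d1%:R * d2%:R) * S2)
  = theta * h * (8 * h + 4) * (d1%:R * d2%:R) * S2 by field; rewrite gt_eqF.
by rewrite ler_wpM2l // !mulr_ge0 // addr_ge0 // mulr_ge0.
Qed.

(** With [theta = 1 / sqrt d2] and [|Q| <= sqrt d2] the exponential is the constant [e^4]. Then
    [theta m d2 = m sqrt d2], and the forbidden switchings [d1 d2] are of that order by
    hypothesis. *)
Lemma light_tail Q (xi : 'I_n -> R) (eta : 'I_m -> R) (s : R) : (0 < d2)%N ->
  d1%:R * d2%:R <= m%:R * Num.sqrt d2%:R :> R ->
  (forall u v, `|Q u v| <= Num.sqrt d2%:R) ->
  (forall u, 0 <= xi u) -> (forall v, 0 <= eta v) ->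
  (forall u v, Q u v ^+ 2 <= xi u * eta v) ->
  \sum_u xi u <= 16 * n%:R -> \sum_v eta v <= 16 * m%:R ->
  #|[set G in Omega | p * (\sum_u \sum_v Q u v)
     + (64 + 256 * expR 4 * (4 * expR 4 + 2) + s) * (m%:R * Num.sqrt d2%:R)
       <= estat Q G]|%:R <= #|Omega|%:R * expR (- (s * m%:R)).
Proof.
move=> d2_gt0 dm Qc xi0 eta0 Qxe xile etale; set r := Num.sqrt d2%:R.
have r0 : 0 < r by rewrite sqrtr_gt0 ltr0n.
have rr : r * r = d2%:R by rewrite -expr2 sqr_sqrtr.
have t0 : 0 <= r^-1 by rewrite invr_ge0 ltW.
have h4 : expR 4 = expR (4 * r * r^-1) by congr expR; rewrite mulfK ?gt_eqF.
have := mgf_drift Q xi eta r r^-1 t0 Qc xi0 eta0 Qxe xile etale _ h4.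
set h := expR 4; set S := \sum_u _; set c := _ + _ + _.
move/(chernoff _ _ _ _ _ (s * (m%:R * r)) _ t0).
rewrite (_ : r^-1 * _ = s * m%:R); last by field; rewrite gt_eqF.
apply: le_trans; rewrite ler_nat; apply/subset_leq_card/fintype.subsetP => G.
rewrite !inE => /andP[-> /=]; apply: le_trans; rewrite /c.
have -> : 256 * r^-1 * h * (4 * h + 2) * (m%:R * d2%:R) = 256 * h * (4 * h + 2) * (m%:R * r).
  by rewrite -rr; field; rewrite gt_eqF.
rewrite -subr_ge0 (_ : _ - _ = 64 * (m%:R * r - d1%:R * d2%:R)); last by clearbody S h; ring.
by rewrite mulr_ge0 // subr_ge0.
Qed.

Definition setstat (S : {set 'I_n}) (T : {set 'I_m}) G : R :=
  estat (fun u v => (u \in S)%:R * (v \in T)%:R) G.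

(** Here the one-edge bound [mgf_edge] is enough: summed over the rectangle it bounds the tilted
    mean of the edge count, and the tilt may grow with [ln (t / mu)]. *)
Lemma discrepancy_tail (S : {set 'I_n}) (T : {set 'I_m}) (t : R) :
  0 < p * (#|S|%:R * #|T|%:R) -> 16 * (p * (#|S|%:R * #|T|%:R)) <= t ->
  #|[set G in Omega | t <= setstat S T G]|%:R <=
    #|Omega|%:R * expR (- (t / 16 * ln (t / (p * (#|S|%:R * #|T|%:R))))).
Proof.
set mu := p * _ => mu0 tmu; set r := t / mu.
pose Q u v : R := (u \in S)%:R * (v \in T)%:R.
have t0 : 0 < t by lra.
have r16 : 16 <= r by rewrite ler_pdivlMr.
(* Half of the logarithm survives because [r >= 16]. With [theta = ln (r / 4) / 4] and a deviation
   of [t / 2] this yields the factor [t / 16]. *)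
have lnr4 : ln r / 2 <= ln (r / 4).
  rewrite lnM ?posrE; try lra; rewrite lnV ?posrE //.
  have : ln 16 <= ln r by rewrite ler_ln ?posrE //; lra.
  have -> : 16 = 4 * 4 :> R by lra.
  rewrite lnM ?posrE //; lra.
have lnr0 : 0 <= ln r by apply: ln_ge0; lra.
(* With this choice the drift bound [2 mu e^(4 theta)] is [t / 2]. *)
set theta := ln (r / 4) / 4.
have th0 : 0 <= theta by rewrite /theta; lra.
have Q1 u v : `|Q u v| <= 1.
  by rewrite ger0_norm ?mulr_ge0 // /Q; do 2![case: (_ \in _)]; rewrite ?mulr0 ?mul0r ?mulr1.
have sumQ : p * (\sum_u \sum_v Q u v) = mu.
  congr (_ * _); under eq_bigr do rewrite -mulr_sumr.
  rewrite -mulr_suml; congr (_ * _).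
    by rewrite -sum1_card natr_sum [in RHS]big_mkcond; apply: eq_bigr => u _; case: (u \in S).
  by rewrite -sum1_card natr_sum [RHS]big_mkcond; apply: eq_bigr => u _; case: (u \in T).
have drift : \sum_(G in Omega) (setstat S T G - t / 2) * expR (theta * setstat S T G) <= 0.
  have -> : \sum_(G in Omega) (setstat S T G - t / 2) * expR (theta * setstat S T G) =
      \sum_(G in Omega) setstat S T G * expR (theta * setstat S T G) - t / 2 * mgf Q theta.
    by rewrite /mgf mulr_sumr -sumrB; apply: eq_bigr => G _; rewrite mulrBl.
  rewrite subr_le0.
  have -> : t / 2 = 2 * expR (4 * 1 * theta) * mu.
    rewrite (_ : 4 * 1 * theta = ln (r / 4)); last by rewrite /theta; lra.
    by rewrite lnK ?posrE; last lra; rewrite /r; field; rewrite gt_eqF.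
  rewrite -sumQ; set e := expR _.
  have -> : 2 * e * (p * \sum_u \sum_v Q u v) * mgf Q theta =
      (\sum_u \sum_v Q u v) * (2 * p * e * mgf Q theta) by ring.
  rewrite /setstat /estat; under eq_bigr do rewrite mulr_suml.
  rewrite exchange_big mulr_suml; apply: ler_sum => u _ /=; under eq_bigr do rewrite mulr_suml.
  rewrite exchange_big mulr_suml; apply: ler_sum => v _ /=.
  under eq_bigr do rewrite -mulrA; rewrite -mulr_sumr.
  by rewrite ler_wpM2l ?mulr_ge0 //; exact: mgf_edge.
have := chernoff _ _ _ _ _ (t / 2) _ th0 drift.
rewrite (_ : t / 2 + t / 2 = t); last by lra.
move/le_trans; apply; rewrite ler_wpM2l // ler_expR lerN2 /theta; nra.
Qed.
End Switching.

(** * Dyadic summation over heavy pairs of levels *)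

Lemma sum_pow4_lt (R : realType) (I : nat) (c : R) :
  0 <= c -> \sum_(i < I | 4 ^+ i < c) 4 ^+ i <= 2 * c.
Proof.
move=> c0; elim: I => [|I IH]; first by rewrite big_ord0 mulr_ge0.
rewrite big_mkcond big_ord_recr -big_mkcond /=; case: ifP => [lt|_]; last by rewrite addr0.
have : \sum_(i < I | 4 ^+ i < c) 4 ^+ i <= 4 ^+ I :> R.
  apply: (@le_trans _ _ (\sum_(i < I) 4 ^+ i)).
    by rewrite [leRHS](bigID (fun i : 'I_I => 4 ^+ i < c)) /= lerDl sumr_ge0 // => i _; exact: exprn_ge0.
  have := subrX1 (4 : R) I; have := exprn_ge0 I (ler0n R 4); nra.
lra.
Qed.

Lemma sum_inv_pow2 (R : realType) (J : nat) : \sum_(j < J) (2 ^+ j)^-1 <= 2 :> R.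
Proof.
have : \sum_(j < J) (2 ^+ j)^-1 = 2 - 2 * (2 ^+ J)^-1 :> R.
  elim: J => [|J IH]; first by rewrite big_ord0 expr0; lra.
  by rewrite big_ord_recr /= IH exprS; field; rewrite gt_eqF ?exprn_gt0.
by move=> ->; rewrite gerBl mulr_ge0 // invr_ge0 exprn_ge0.
Qed.

Lemma sum_inv_pow4 (R : realType) (J : nat) : \sum_(j < J) (4 ^+ j)^-1 <= 2 :> R.
Proof.
apply: le_trans (sum_inv_pow2 R J); apply: ler_sum => j _.
rewrite lef_pV2 ?posrE ?exprn_gt0 //; apply: lerXn2r; rewrite ?nnegrE; lra.
Qed.

Lemma sum_inv_pow2_ge (R : realType) (J : nat) (c : R) :
  0 < c -> \sum_(j < J | c <= 2 ^+ j) (2 ^+ j)^-1 <= 2 / c.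
Proof.
elim: J c => [|J IH] c c0; first by rewrite big_ord0 divr_ge0 // ltW.
have [c1|c1] := leP c 1.
  apply: (@le_trans _ _ (\sum_(j < J.+1) (2 ^+ j)^-1)).
    rewrite [leRHS](bigID (fun j : 'I_J.+1 => c <= 2 ^+ j)) /= lerDl sumr_ge0 // => j _.
    by rewrite invr_ge0 exprn_ge0.
  by apply: le_trans (sum_inv_pow2 R _) _; rewrite ler_pMr // invf_ge1.
rewrite big_mkcond big_ord_recl /= expr0 (lt_geF c1) add0r /=.
have -> : \sum_(i < J) (if c <= 2 ^+ bump 0 i then (2 ^+ bump 0 i)^-1 else 0) =
    2^-1 * \sum_(i < J | c / 2 <= 2 ^+ i) (2 ^+ i)^-1 :> R.
  rewrite mulr_sumr [RHS]big_mkcond; apply: eq_bigr => i _.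
  by rewrite /bump /= add1n exprS ler_pdivrMr // (mulrC _ 2) invfM; case: ifP.
have c2 : 0 < c / 2 by lra.
by have := IH _ c2; rewrite invfM invrK; lra.
Qed.

Lemma expR1_le4 (R : realType) : expR 1 <= 4 :> R.
Proof.
have h : expR (2^-1) <= 2 :> R.
  have := expR_ge1Dx (- 2^-1 : R); have := expRxMexpNx_1 (2^-1 : R).
  have := expR_gt0 (2^-1 : R); nra.
rewrite (_ : 1 = 2^-1 + 2^-1 :> R); last by field.
by rewrite expRD; have := expR_gt0 (2^-1 : R); nra.
Qed.

(** The fourth power of the left side is [e M t^3]; the bound on [t] and [16^3 = 8^4] conclude. The
    exponential is the fourth root of [e M / t], so a level of size [16 M / 16^j] still leaves a
    decay of [8^(- j)]. *)
Lemma sparse_level_le (R : realType) (j : nat) (t M : R) :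
  0 < t -> 0 < M -> 16 ^+ j * t <= 16 * M ->
  t * expR ((1 + ln (M / t)) / 4) <= 16 * M / 8 ^+ j.
Proof.
move=> t0 M0 tM; set y := expR _.
have y4 : y ^+ 4 = expR 1 * (M / t).
  rewrite /y -expRM_natl (_ : 4%:R * _ = 1 + ln (M / t)); last by field.
  by rewrite expRD lnK // posrE divr_gt0.
have y0 : 0 <= y by exact: expR_ge0.
rewrite -(ler_pXn2r (n := 4)) ?nnegrE //; first last.
- by rewrite divr_ge0 ?exprn_ge0 // mulr_ge0 // ltW.
- by rewrite mulr_ge0 // ltW.
rewrite exprMn y4 (_ : t ^+ 4 * _ = expR 1 * M * t ^+ 3); last by field; rewrite gt_eqF.
have t3 : t ^+ 3 <= (16 * M / 16 ^+ j) ^+ 3.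
  rewrite lerXn2r ?nnegrE ?(ltW t0) //; first by rewrite divr_ge0 ?exprn_ge0 // mulr_ge0 // ltW.
  by rewrite ler_pdivlMr ?exprn_gt0 // mulrC.
have e16 : expR 1 <= 16 :> R by have := expR1_le4 R; lra.
apply: (@le_trans _ _ (16 * M * (16 * M / 16 ^+ j) ^+ 3)).
  by apply: ler_pM; rewrite ?mulr_ge0 ?expR_ge0 ?exprn_ge0 ?(ltW t0) ?(ltW M0) //
    ler_wpM2r // ltW.
rewrite !expr_div_n -!exprM mulnC (mulnC j) !exprM.
rewrite (_ : 16 ^+ 3 = 8 ^+ 4 :> R); last by ring.
by rewrite mulrA -exprS.
Qed.

(** Here [s], [t] are level sizes and [e] edge counts between levels. The statement is abstract
    because it is applied twice with the two sides exchanged; the alternative [e i j = 0] covers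
    pairs of levels treated elsewhere. *)
Lemma heavy_pairs (R : realType) (I J : nat) (s t : nat -> R) (e : nat -> nat -> R)
    (N M W D d p kappa : R) :
  0 < d -> 0 <= p -> 0 <= N -> 0 < M -> 0 <= kappa -> 
  (forall i, 0 <= s i) -> (forall j, 0 <= t j) -> (forall i j, 0 <= e i j) ->
  \sum_(i < I) 16 ^+ i * s i <= 16 * N -> \sum_(j < J) 16 ^+ j * t j <= 16 * M ->
  0 <= D -> (forall i, \sum_(j < J) e i j <= D * s i) ->
  (forall i j, e i j = 0 \/ [/\ [/\ 0 < s i, 0 < t j & t j <= M], 0 < p,
     16 * (p * (s i * t j)) <= e i j &
     e i j * ln (e i j / (p * (s i * t j))) <= kappa * (t j * (1 + ln (M / t j)))]) ->
  p * N * M <= d * W -> M <= W -> D * N <= W * d ->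
  \sum_(i < I) \sum_(j < J) 4 ^+ i * 4 ^+ j * e i j <= (528 + 384 * kappa) * (W * Num.sqrt d).
Proof.
move=> d0 p0 N0 M0 k0 s0 t0 e0 sN tM D0 eD He pNM MW DN; set r := Num.sqrt d.
have r0 : 0 < r by rewrite sqrtr_gt0.
have rr : r * r = d by rewrite -expr2 sqr_sqrtr ?ltW.
have W0 : 0 < W by lra.
have P (k : nat) (b : R) : 0 < b -> 0 < b ^+ k by move=> ?; rewrite exprn_gt0.
have P4 (k : nat) : 0 <= 4 ^+ k :> R by rewrite exprn_ge0.
have P2 (k : nat) : 0 <= 2 ^+ k :> R by rewrite exprn_ge0.
have P16 (k : nat) : 0 <= 16 ^+ k :> R by rewrite exprn_ge0.
have M00 := ltW M0; have r00 := ltW r0.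
(* With [q = e / (p s t)] and [y = exp ((1 + ln (M / t)) / 4)]: [b0] uses the degree
   bound, [b1] the case [q >= y], where [e <= 4 kappa t]; for [q < y], [b2] uses
   [e < p s t y] and [b3] uses [e <= 4 kappa t y]. *)
pose b0 (i j : nat) := if r * 4 ^+ j <= 4 ^+ i then 4 ^+ i * 4 ^+ j * e i j else 0.
pose b1 (i j : nat) := if 4 ^+ i < r * 4 ^+ j then 4 ^+ i * 4 ^+ j * (4 * kappa * t j) else 0.
pose b2 (i j : nat) := if r / 4 ^+ i <= 2 ^+ j then 16 * p * M * s i * 4 ^+ i * (2 ^+ j)^-1 else 0.
pose b3 (i j : nat) := if 4 ^+ i < r / 2 ^+ j then 64 * kappa * M * 4 ^+ i * (2 ^+ j)^-1 else 0.
have b00 i j : 0 <= b0 i j by rewrite /b0; case: ifP => // _; rewrite !mulr_ge0 ?P4 ?P2 ?P16 //.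
have b10 i j : 0 <= b1 i j by rewrite /b1; case: ifP => // _; rewrite !mulr_ge0 ?P4 ?P2 ?P16 //.
have b20 i j : 0 <= b2 i j.
  by rewrite /b2; case: ifP => // _; rewrite !mulr_ge0 ?invr_ge0 ?P4 ?P2 ?P16 //.
have b30 i j : 0 <= b3 i j.
  by rewrite /b3; case: ifP => // _; rewrite !mulr_ge0 ?invr_ge0 ?P4 ?P2 ?P16 //.
have key (i j : nat) : (j < J)%N -> 4 ^+ i * 4 ^+ j * e i j <= b0 i j + b1 i j + b2 i j + b3 i j.
  move=> jJ; have [c0|c0] := leP (r * 4 ^+ j) (4 ^+ i).
    by rewrite {1}/b0 c0; have := b10 i j; have := b20 i j; have := b30 i j; lra.
  case: (He i j) => [->|[[si tj tjM] p0' emu elog]].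
    by rewrite mulr0 !addr_ge0.
  have mu0 : 0 < p * (s i * t j) by rewrite !mulr_gt0.
  set L := 1 + ln (M / t j) in elog; set y := expR (L / 4).
  have tj16 : 16 ^+ j * t j <= 16 * M.
    apply: le_trans tM; rewrite (bigD1 (Ordinal jJ)) //= lerDl sumr_ge0 // => k _.
    by rewrite mulr_ge0 ?P4 ?P2 ?P16 //.
  have ty := sparse_level_le R j (t j) M tj M0 tj16; rewrite -/L -/y in ty.
  have L0 : 1 <= L by rewrite lerDl ln_ge0 // ler_pdivlMr // mul1r.
  set q := e i j / _ in elog.
  have q16 : 16 <= q by rewrite ler_pdivlMr.
  have q0 : 0 < q by lra.
  have p44 : 0 <= 4 ^+ i * 4 ^+ j :> R by rewrite mulr_ge0 ?P4 ?P2 ?P16 //.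
  have p8 : 4 ^+ i * 4 ^+ j * (16 * M / 8 ^+ j) = 16 * M * 4 ^+ i * (2 ^+ j)^-1.
    rewrite (_ : 8 = 4 * 2 :> R); last by lra.
    by rewrite exprMn; field; rewrite !gt_eqF ?P.
  have [qy|qy] := leP (L / 4) (ln q).
    have : e i j <= 4 * kappa * t j.
      have : e i j * (L / 4) <= kappa * (t j * L) by apply: le_trans elog; rewrite ler_wpM2l.
      have L00 : 0 < L / 4 by lra.
      move=> h; rewrite -(ler_pM2r L00).
      by rewrite [leRHS](_ : _ = kappa * (t j * L)) //; field.
    move/(ler_wpM2l p44) => h.
    have -> : b1 i j = 4 ^+ i * 4 ^+ j * (4 * kappa * t j) by rewrite /b1 c0.
    by have := b00 i j; have := b20 i j; have := b30 i j; lra.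
  have [c2|c2] := leP (r / 4 ^+ i) (2 ^+ j).
    have eq1 : e i j = q * (p * (s i * t j)) by rewrite divfK ?gt_eqF.
    have qlt : q <= y by rewrite -[q]lnK ?posrE // ler_expR ltW.
    have h : e i j <= p * s i * (16 * M / 8 ^+ j).
      apply: (@le_trans _ _ (p * s i * (t j * y))).
        by rewrite eq1 [leRHS](_ : _ = y * (p * (s i * t j))); [rewrite ler_wpM2r // ltW|ring].
      by rewrite ler_wpM2l // mulr_ge0.
    have -> : b2 i j = p * s i * (16 * M * 4 ^+ i * (2 ^+ j)^-1) by rewrite /b2 c2; ring.
    have := ler_wpM2l p44 h; rewrite mulrCA p8.
    by have := b00 i j; have := b10 i j; have := b30 i j; lra.
  have c3 : 4 ^+ i < r / 2 ^+ j by rewrite ltr_pdivlMr ?P // mulrC -ltr_pdivlMr ?P.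
  have h : e i j <= 4 * kappa * (16 * M / 8 ^+ j).
    have lnq1 : 1 <= ln q.
      rewrite -ler_expR lnK ?posrE //; have := expR1_le4 R; lra.
    apply: (@le_trans _ _ (kappa * (t j * L))).
      by apply: le_trans elog; rewrite ler_peMr.
    apply: (@le_trans _ _ (4 * kappa * (t j * y))); last by rewrite ler_wpM2l // mulr_ge0.
    have L4 : L <= 4 * y by have := expR_ge1Dx (L / 4); rewrite -/y; lra.
    rewrite [leRHS](_ : _ = kappa * (t j * (4 * y))); last by ring.
    by rewrite ler_wpM2l // ler_wpM2l.
  have -> : b3 i j = 4 * kappa * (16 * M * 4 ^+ i * (2 ^+ j)^-1) by rewrite /b3 c3; ring.
  have := ler_wpM2l p44 h; rewrite mulrCA p8.
  by have := b00 i j; have := b10 i j; have := b20 i j; lra.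
(* The degree bound sums [b0] over [j]. The others are geometric: [b1] over [i], [b2] over [j], and
   [b3] over [i] and then over [j]. The totals give [528 = 16 + 512] and [384 = 128 + 256]. *)
have S0 : \sum_(i < I) \sum_(j < J) b0 i j <= 16 * (W * r).
  apply: (@le_trans _ _ (\sum_(i < I) (D / r) * (16 ^+ i * s i))).
    apply: ler_sum => i _; apply: (@le_trans _ _ (\sum_(j < J) (16 ^+ i / r) * e i j)).
      apply: ler_sum => j _; rewrite /b0; case: ifP => [c|_]; last first.
        by rewrite !mulr_ge0 ?invr_ge0 ?P4 ?P2 ?P16 //.
      rewrite ler_wpM2r // ler_pdivlMr // (_ : 16 = 4 * 4 :> R); last by ring.
      by rewrite exprMn -mulrA ler_wpM2l ?P4 ?P2 ?P16 // mulrC.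
    rewrite -mulr_sumr [leRHS](_ : _ = 16 ^+ i / r * (D * s i)); last by ring.
    by rewrite ler_wpM2l // mulr_ge0 ?invr_ge0 ?P4 ?P2 ?P16 //.
  rewrite -mulr_sumr; apply: (@le_trans _ _ (D / r * (16 * N))).
    by rewrite ler_wpM2l // divr_ge0 //.
  rewrite (_ : _ * _ = 16 * (D * N / r)); last by ring.
  by rewrite ler_wpM2l // ler_pdivrMr // -mulrA rr.
have S1 : \sum_(i < I) \sum_(j < J) b1 i j <= 128 * kappa * (W * r).
  rewrite exchange_big /=.
  apply: (@le_trans _ _ (\sum_(j < J) (8 * kappa * r) * (16 ^+ j * t j))).
    apply: ler_sum => j _; rewrite /b1 -big_mkcond -mulr_suml -mulr_suml.
    have rj : 0 <= r * 4 ^+ j by rewrite mulr_ge0 ?P4 ?P2 ?P16 //.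
    apply: (@le_trans _ _ (2 * (r * 4 ^+ j) * 4 ^+ j * (4 * kappa * t j))).
      rewrite ler_wpM2r ?mulr_ge0 // ler_wpM2r ?P4 //; exact: sum_pow4_lt.
    rewrite le_eqVlt; apply/orP; left; apply/eqP.
    rewrite (_ : 16 = 4 * 4 :> R); last by ring.
    by rewrite exprMn; ring.
  rewrite -mulr_sumr; apply: (@le_trans _ _ (8 * kappa * r * (16 * M))).
    by rewrite ler_wpM2l // !mulr_ge0 //.
  rewrite (_ : 8 * kappa * r * (16 * M) = 128 * kappa * (M * r)); last by ring.
  by rewrite ler_wpM2l ?mulr_ge0 // ler_wpM2r //.
have S2 : \sum_(i < I) \sum_(j < J) b2 i j <= 512 * (W * r).
  apply: (@le_trans _ _ (\sum_(i < I) (32 * p * M / r) * (16 ^+ i * s i))).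
    apply: ler_sum => i _; rewrite /b2 -big_mkcond -mulr_sumr.
    have ri : 0 < r / 4 ^+ i by rewrite divr_gt0 ?P.
    apply: (@le_trans _ _ (16 * p * M * s i * 4 ^+ i * (2 / (r / 4 ^+ i)))).
      rewrite ler_wpM2l ?mulr_ge0 ?P4 //; exact: sum_inv_pow2_ge.
    rewrite le_eqVlt; apply/orP; left; apply/eqP.
    rewrite (_ : 16 ^+ i = 4 ^+ i * 4 ^+ i :> R); last by rewrite -exprMn; congr (_ ^+ _); ring.
    by field; rewrite !gt_eqF ?P.
  rewrite -mulr_sumr; apply: (@le_trans _ _ (32 * p * M / r * (16 * N))).
    by rewrite ler_wpM2l // !mulr_ge0 ?invr_ge0 //.
  rewrite (_ : _ * _ = 512 * (p * N * M / r)); last by ring.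
  by rewrite ler_wpM2l // ler_pdivrMr // -(mulrA W) rr (mulrC W).
have S3 : \sum_(i < I) \sum_(j < J) b3 i j <= 256 * kappa * (W * r).
  rewrite exchange_big /=.
  apply: (@le_trans _ _ (\sum_(j < J) (128 * kappa * M * r) * (4 ^+ j)^-1)).
    apply: ler_sum => j _; rewrite /b3 -big_mkcond -mulr_suml -mulr_sumr.
    have rj : 0 <= r / 2 ^+ j by rewrite divr_ge0 ?P4 ?P2 ?P16 //.
    apply: (@le_trans _ _ (64 * kappa * M * (2 * (r / 2 ^+ j)) / 2 ^+ j)).
      rewrite ler_wpM2r ?invr_ge0 ?P2 // ler_wpM2l ?mulr_ge0 //; exact: sum_pow4_lt.
    rewrite le_eqVlt; apply/orP; left; apply/eqP.
    rewrite (_ : 4 ^+ j = 2 ^+ j * 2 ^+ j :> R); last by rewrite -exprMn; congr (_ ^+ _); ring.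
    by field; rewrite !gt_eqF ?P.
  rewrite -mulr_sumr; apply: (@le_trans _ _ (128 * kappa * M * r * 2)).
    by rewrite ler_wpM2l ?sum_inv_pow4 // !mulr_ge0 //.
  rewrite (_ : _ * 2 = 256 * kappa * (M * r)); last by ring.
  by rewrite ler_wpM2l ?mulr_ge0 // ler_wpM2r //.
apply: (@le_trans _ _ (\sum_(i < I) \sum_(j < J) (b0 i j + b1 i j + b2 i j + b3 i j))).
  by apply: ler_sum => i _; apply: ler_sum => j _; exact: key.
under eq_bigr do rewrite !big_split /=.
rewrite !big_split /=; lra.
Qed.

(** * Union bounds *)

Lemma card_union_le (T I : finType) (A : {set T}) (J : pred I) (P : I -> pred T) :
  (#|[set x in A | [exists (i | J i), P i x]]| <= \sum_(i | J i) #|[set x in A | P i x]|)%N.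
Proof.
have E (Q : pred T) : #|[set x in A | Q x]| = (\sum_(x in A) Q x)%N.
  by rewrite -sum1_card big_mkcond [RHS]big_mkcond; apply: eq_bigr => x _; rewrite inE; case: (x \in A); case: (Q x).
rewrite (E (fun x => [exists (i | J i), P i x])).
under [X in (_ <= X)%N]eq_bigr => i _ do rewrite (E (P i)).
rewrite exchange_big /=.
apply: leq_sum => x _; case: existsP => // -[i /andP[Ji Pi]].
by rewrite (bigD1 i) //= Pi.
Qed.

(** Its exponential is the classical bound [(e n / a)^a] on the number of subsets of size [a]. *)
Definition entropy (R : realType) (n a : nat) : R := a%:R * (1 + ln (n%:R / a%:R)).

(** One term of the binomial expansion of [(1 + x)^n] at [x = a / n] is at most the whole, which is
    at most [e^a]. *)
Lemma bin_le_entropy (R : realType) (n a : nat) : (0 < a <= n)%N ->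
  'C(n, a)%:R <= expR (entropy R n a).
Proof.
case/andP=> a0 an; have n0 : (0 < n)%N by apply: leq_trans an.
have A0 : 0 < a%:R :> R by rewrite ltr0n.
have N0 : 0 < n%:R :> R by rewrite ltr0n.
set x : R := a%:R / n%:R; have x0 : 0 < x by rewrite divr_gt0.
have h1 : 'C(n, a)%:R * x ^+ a <= (1 + x) ^+ n.
  rewrite exprDn (bigD1 (inord a)) //= inordK ?ltnS // expr1n mul1r mulr_natl lerDl.
  by apply: sumr_ge0 => i _; rewrite mulrn_wge0 // expr1n mul1r exprn_ge0 // ltW.
have h2 : (1 + x) ^+ n <= expR a%:R.
  have -> : a%:R = n%:R * x by rewrite /x mulrC divfK ?gt_eqF.
  rewrite expRM_natl lerXn2r ?nnegrE ?expR_ge0 ?expR_ge1Dx //; lra.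
have -> : expR (entropy R n a) = expR a%:R / x ^+ a.
  rewrite /entropy mulrDr mulr1 expRD expRM_natl lnK ?posrE ?divr_gt0 //.
  by rewrite -exprVn invf_div.
by rewrite ler_pdivlMr ?exprn_gt0 // (le_trans h1).
Qed.

(** One unit of entropy pays for a factor [n]. The reason is [ln a <= a - 1]. *)
Lemma ln_le_entropy (R : realType) (n a : nat) : (0 < a <= n)%N ->
  ln n%:R <= entropy R n a.
Proof.
case/andP=> a0 an; have n0 : (0 < n)%N by apply: leq_trans an.
have A0 : 0 < a%:R :> R by rewrite ltr0n.
have N0 : 0 < n%:R :> R by rewrite ltr0n.
have A1 : 1 <= a%:R :> R by rewrite ler1n.
have q : 1 <= n%:R / a%:R :> R by rewrite ler_pdivlMr // mul1r ler_nat.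
have -> : ln n%:R = ln (n%:R / a%:R) + ln a%:R :> R.
  by rewrite -lnM ?posrE ?divr_gt0 // divfK ?gt_eqF.
rewrite /entropy.
have l0 := ln_ge0 q.
have : ln a%:R <= a%:R - 1 :> R.
  have h : -1 < a%:R - 1 :> R by lra.
  by have := le_ln1Dx h; rewrite (_ : 1 + (a%:R - 1) = a%:R); [|ring].
nra.
Qed.

Lemma sum_set_card (R : realType) (n : nat) (F : nat -> R) :
  \sum_(S : {set 'I_n}) F #|S| = \sum_(a < n.+1) 'C(n, a)%:R * F a.
Proof.
have cS (S : {set 'I_n}) : (#|S| < n.+1)%N by rewrite ltnS -[X in (_ <= X)%N](card_ord n) max_card.
rewrite (partition_big (fun S : {set 'I_n} => Ordinal (cS S)) xpredT) //=.
apply: eq_bigr => a _; rewrite (eq_bigr (fun=> F a)); last by move=> S /eqP <-.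
rewrite sumr_const mulr_natl; congr (_ *+ _).
have -> : 'C(n, a) = 'C(#|'I_n|, a) by rewrite card_ord.
by rewrite -card_draws; apply: eq_card => S; rewrite !inE.
Qed.

(** Of the [K + 2] units of entropy, one pays for the choice of a set of given size and the others
    give [n^(- K - 1)]; there are [n] nonzero sizes. *)
Lemma sum_entropy (R : realType) (n : nat) (K : R) : (0 < n)%N -> 0 <= K ->
  \sum_(S : {set 'I_n} | S != set0) expR (- ((K + 2) * entropy R n #|S|)) <=
  powR n%:R (- K).
Proof.
move=> n0 K0; have N0 : 0 < n%:R :> R by rewrite ltr0n.
rewrite big_mkcond /=.
pose F a := if a == 0%N then 0 else expR (- ((K + 2) * entropy R n a)).
rewrite (eq_bigr (fun S : {set 'I_n} => F #|S|)); last first.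
  by move=> S _; rewrite /F cards_eq0; case: (S == set0).
rewrite (sum_set_card R n F) big_ord_recl /F eqxx mulr0 add0r /=.
have -> : powR n%:R (- K) = \sum_(a < n) expR (- ((K + 1) * ln n%:R)) :> R.
  rewrite sumr_const card_ord -[RHS]mulr_natl -[X in _ = X * _](@lnK R) ?posrE // -expRD.
  by rewrite /powR gt_eqF //; congr expR; ring.
apply: ler_sum => a _; rewrite /bump /= add1n.
have an : (0 < a.+1 <= n)%N by rewrite ltn_ord.
apply: (@le_trans _ _ (expR (entropy R n a.+1) * expR (- ((K + 2) * entropy R n a.+1)))).
  by rewrite ler_wpM2r ?expR_ge0 // bin_le_entropy.
rewrite -expRD ler_expR; have := ln_le_entropy R n a.+1 an; nra.
Qed.

(** The cap [4 k] on absolute values leaves room for all of [gball], whose coordinates are at most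
    [4 sqrt k]. *)
Local Notation grid k := {ffun 'I_k -> bool * 'I_(4 * k).+1}.

Section Unions.
Context (R : realType) (n m d1 d2 : nat).
Hypotheses (n_gt0 : (0 < n)%N) (m_gt0 : (0 < m)%N) (d1_gt0 : (0 < d1)%N) (d2_gt0 : (0 < d2)%N).
Hypotheses (edges : (n * d1 = m * d2)%N) (d2_small : (4 * d2 <= n)%N).
Local Notation Omega := (biregular n m d1 d2).
Local Notation p := (d2%:R / n%:R : R).
Implicit Types (S : {set 'I_n}) (T : {set 'I_m}) (G : bigraph n m).

Definition setmean S T : R := p * (#|S|%:R * #|T|%:R).

(** The failure of the Kahn-Szemeredi discrepancy property, in which an edge count is either below
    16 times its mean or controlled by the entropy of the two sets. *)
Definition discrepant (c : R) S T G : bool :=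
  (16 * setmean S T <= setstat R n m S T G) &&
  (16 * c * (entropy R n #|S| + entropy R m #|T|) <
     setstat R n m S T G * ln (setstat R n m S T G / setmean S T)).

Lemma setstat_nat S T G : exists t : nat, setstat R n m S T G = t%:R.
Proof.
exists (\sum_u \sum_v (u \in S) * (v \in T) * ((u, v) \in G))%N.
rewrite /setstat /estat natr_sum; apply: eq_bigr => u _; rewrite natr_sum.
by apply: eq_bigr => v _; rewrite !natrM.
Qed.

(** The event is not a threshold event. Edge counts being integers, it lies in [t <= setstat] for
    the least [t] satisfying both inequalities, and the tail bound at this [t] is the desired
    one. *)
Lemma card_discrepant (c : R) S T : S != set0 -> T != set0 ->
  #|[set G in Omega | discrepant c S T G]|%:R <=
  #|Omega|%:R * expR (- (c * (entropy R n #|S| + entropy R m #|T|))).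
Proof.
move=> S0 T0; set ent := _ + _.
have mu0 : 0 < setmean S T.
  by rewrite /setmean !mulr_gt0 ?invr_gt0 ?ltr0n ?card_gt0.
pose P t := (16 * setmean S T <= t%:R) && (16 * c * ent < t%:R * ln (t%:R / setmean S T)).
have badP G : discrepant c S T G -> exists2 t, P t & setstat R n m S T G = t%:R.
  by case: (setstat_nat S T G) => t tE; rewrite /discrepant tE => h; exists t.
case: (pickP [pred G in Omega | discrepant c S T G]) => [G0 /andP[_ bG0]|none]; last first.
  rewrite (_ : #|_| = 0%N) ?mulr_ge0 ?expR_ge0 //.
  by apply: eq_card0 => G; rewrite inE; exact: none.
have exP : exists t, P t by have [t Pt _] := badP _ bG0; exists t.
case: (ex_minnP exP) => t /andP[Pt1 Pt2] tmin.
apply: le_trans (_ : #|[set G in Omega | t%:R <= setstat R n m S T G]|%:R <= _).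
  rewrite ler_nat; apply/subset_leq_card/fintype.subsetP => G; rewrite !inE => /andP[-> /=].
  by case/badP => t' Pt' ->; rewrite ler_nat tmin.
apply: le_trans (discrepancy_tail R n m d1 d2 n_gt0 d1_gt0 d2_small S T t%:R mu0 Pt1) _.
by rewrite ler_wpM2l // ler_expR lerN2 -/(setmean S T); lra.
Qed.

(** The sum over pairs of sets factors: the left factor is at most [n^(- K) <= 1], the right one
    supplies [m^(- K)]. *)
Lemma discrepancy_union (K : R) : 0 <= K ->
  #|[set G in Omega | [exists (ST | (ST.1 != set0) && (ST.2 != set0)),
      discrepant (K + 2) ST.1 ST.2 G]]|%:R <= #|Omega|%:R * powR m%:R (- K).
Proof.
move=> K0.
have := card_union_le _ _ Omega (fun ST : {set 'I_n} * {set 'I_m} => (ST.1 != set0) && (ST.2 != set0))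
  (fun ST => discrepant (K + 2) ST.1 ST.2).
rewrite -(ler_nat R) => /le_trans; apply; rewrite natr_sum.
apply: (@le_trans _ _ (\sum_(ST : {set 'I_n} * {set 'I_m} | (ST.1 != set0) && (ST.2 != set0))
   #|Omega|%:R * (expR (- ((K + 2) * entropy R n #|ST.1|)) * expR (- ((K + 2) * entropy R m #|ST.2|))))).
  apply: ler_sum => -[S T] /andP[S0 T0]; apply: le_trans (card_discrepant _ _ _ S0 T0) _.
  by rewrite -expRD -opprD -mulrDr.
rewrite -mulr_sumr ler_wpM2l //.
rewrite -(pair_big (fun S : {set 'I_n} => S != set0) (fun T : {set 'I_m} => T != set0)
  (fun S T => expR (- ((K + 2) * entropy R n #|S|)) * expR (- ((K + 2) * entropy R m #|T|)))) /=.
under eq_bigr do rewrite -mulr_sumr.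
rewrite -mulr_suml -[leRHS]mul1r; apply: ler_pM.
- by apply: sumr_ge0 => S _; exact: expR_ge0.
- by apply: sumr_ge0 => S _; exact: expR_ge0.
- apply: le_trans (sum_entropy R n K n_gt0 K0) _.
  rewrite /powR gt_eqF ?ltr0n // -[leRHS]expR0 ler_expR mulNr oppr_le0 mulr_ge0 //.
  by rewrite ln_ge0 // ler1n.
- exact: sum_entropy.
Qed.

(* A grid coordinate is a sign and an absolute value; 0 has two codes. *)
Definition gabs k (x : grid k) (i : 'I_k) : nat := (x i).2.
Definition gval k (x : grid k) (i : 'I_k) : R := (-1) ^+ (x i).1 * (gabs k x i)%:R.

(** Vectors of norm at most 1, scaled by [4 sqrt k] and rounded towards zero, land in this ball. *)
Definition gball k : pred (grid k) := fun x => (\sum_i gabs k x i ^ 2 <= 16 * k)%N.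

(** Exponential Markov: since [a <= a^2], the indicator of the ball is at most [e^(16 k)] times the
    product of the [e^(- a_i)]. Each coordinate, sign included, then sums to at most [4 <= e^2]. *)
Lemma card_gball k : #|[pred x | gball k x]|%:R <= expR (18 * k%:R) :> R.
Proof.
rewrite -sum1_card natr_sum.
apply: (@le_trans _ _ (\sum_(x : grid k) expR (16 * k%:R) * \prod_i expR (- (gabs k x i)%:R))).
  rewrite [leRHS](bigID (gball k)) /=; apply: ler_wpDr.
    by apply: sumr_ge0 => x _; rewrite mulr_ge0 ?expR_ge0 // prodr_ge0 // => i _; exact: expR_ge0.
  apply: ler_sum => x xb; rewrite -expR_sum -expRD -[leLHS]expR0 ler_expR.
  rewrite sumrN subr_ge0 -natr_sum -natrM ler_nat; apply: leq_trans xb.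
  by apply: leq_sum => i _; case: (gabs k x i) => // a; rewrite leq_pmulr.
rewrite -mulr_sumr (_ : 18 * k%:R = 16 * k%:R + k%:R * 2 :> R); last by ring.
rewrite expRD ler_wpM2l ?expR_ge0 // expRM_natl.
have -> : \sum_(x : grid k) \prod_i expR (- (gabs k x i)%:R) =
   \prod_(i < k) \sum_(a : bool * 'I_(4 * k).+1) expR (- (a.2 : nat)%:R) :> R.
  by rewrite bigA_distr_bigA.
rewrite prodr_const card_ord lerXn2r ?nnegrE ?expR_ge0 //.
  by apply: sumr_ge0 => a _; exact: expR_ge0.
have e2 : 2 <= expR 1 :> R by have := expR_ge1Dx (1 : R); lra.
rewrite -(pair_big xpredT xpredT (fun (_ : bool) (a : 'I_(4 * k).+1) => expR (- (a : nat)%:R))) /=.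
rewrite sumr_const card_bool.
have : \sum_(a < (4 * k).+1) expR (- a%:R) <= 2 :> R.
  apply: le_trans (sum_inv_pow2 R (4 * k).+1); apply: ler_sum => a _.
  rewrite expRN lef_pV2 ?posrE ?exprn_gt0 ?expR_gt0 // -[a%:R]mulr1 expRM_natl.
  by rewrite lerXn2r ?nnegrE ?expR_ge0.
have -> : 2 = 1 + 1 :> R by lra.
by rewrite expRD mulr2n; nra.
Qed.

Definition light (x : grid n) (y : grid m) u v : R :=
  if `|gval n x u * gval m y v| <= Num.sqrt d2%:R then gval n x u * gval m y v else 0.

(* 37 = 18 + 18 + 1: there are at most [expR (18 n + 18 m)] pairs of grid vectors. *)
Definition light_const : R := 64 + 256 * expR 4 * (4 * expR 4 + 2) + 37.

Definition light_bad (xy : grid n * grid m) G : bool :=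
  p * (\sum_u \sum_v light xy.1 xy.2 u v) + light_const * (m%:R * Num.sqrt d2%:R)
   <= estat R n m (light xy.1 xy.2) G.

Lemma gval_sqr k (x : grid k) i : gval k x i ^+ 2 = (gabs k x i ^ 2)%N%:R.
Proof. by rewrite exprMn -exprM mulnC exprM sqrrN !expr1n mul1r natrX. Qed.

Lemma gball_sum k (x : grid k) : gball k x -> \sum_i gval k x i ^+ 2 <= 16 * k%:R.
Proof.
by rewrite /gball -(ler_nat R) natr_sum natrM; under [in X in _ -> X]eq_bigr do rewrite gval_sqr.
Qed.

Lemma light_union : (n <= m)%N ->
  d1%:R * d2%:R <= m%:R * Num.sqrt d2%:R :> R ->
  #|[set G in Omega | [exists (xy | gball n xy.1 && gball m xy.2), light_bad xy G]]|%:R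
   <= #|Omega|%:R * expR (- m%:R) :> R.
Proof.
move=> nm dm.
have := card_union_le _ _ Omega (fun xy : grid n * grid m => gball n xy.1 && gball m xy.2) light_bad.
rewrite -(ler_nat R) => /le_trans; apply; rewrite natr_sum.
apply: (@le_trans _ _ (\sum_(xy : grid n * grid m | gball n xy.1 && gball m xy.2)
   #|Omega|%:R * expR (- (37 * m%:R)))).
  apply: ler_sum => -[x y] /= /andP[xb yb].
  have := light_tail R n m d1 d2 n_gt0 d1_gt0 edges d2_small (light x y)
   (fun u => gval n x u ^+ 2) (fun v => gval m y v ^+ 2) 37 d2_gt0 dm.
  apply.
  - by move=> u v; rewrite /light; case: ifP => //; rewrite normr0 sqrtr_ge0.
  - by move=> u; exact: sqr_ge0.
  - by move=> v; exact: sqr_ge0.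
  - move=> u v; rewrite /light; case: ifP => _; first by rewrite exprMn.
    by rewrite expr0n mulr_ge0 ?sqr_ge0.
  - exact: gball_sum.
  - exact: gball_sum.
rewrite sumr_const -[leLHS]mulr_natl mulrCA ler_wpM2l //.
have -> : #|[pred xy : grid n * grid m | gball n xy.1 && gball m xy.2]| =
   (#|[pred x | gball n x]| * #|[pred y | gball m y]|)%N.
  by rewrite -cardX; apply: eq_card => -[x y]; rewrite !inE.
rewrite natrM.
apply: (@le_trans _ _ (expR (18 * n%:R) * expR (18 * m%:R) * expR (- (37 * m%:R)))).
  by rewrite ler_wpM2r ?expR_ge0 // ler_pM // card_gball.
have : n%:R <= m%:R :> R by rewrite ler_nat.
by rewrite -!expRD ler_expR; lra.
Qed.

End Unions.

(** * Heavy couples *)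

Section Levels.
Context (R : realType) (N : nat) (k : 'I_N -> nat).

(** The guard keeps zero coordinates out of level 0, as [trunc_log 4 0 = 0]. *)
Definition level (i : nat) : {set 'I_N} :=
  [set u | (0 < k u)%N && (trunc_log 4 (k u) == i)].

Lemma sum_level (B : nat) (F : nat -> R) u : (forall i, 0 <= F i) ->
  \sum_(i < B) (u \in level i)%:R * F i <= if (0 < k u)%N then F (trunc_log 4 (k u)) else 0.
Proof.
move=> F0; case: ifP => ku; last first.
  by rewrite big1 // => i _; rewrite inE ku mul0r.
have [lt|ge] := ltnP (trunc_log 4 (k u)) B.
  rewrite (bigD1 (Ordinal lt)) //= big1 ?addr0; first by rewrite inE ku eqxx mul1r.
  by move=> i; rewrite -val_eqE /= eq_sym inE ku => /negbTE -> /=; rewrite mul0r.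
rewrite big1 // => i _; rewrite inE ku /=; case: eqP => [E|_]; last by rewrite mul0r.
by have := leq_trans (ltn_ord i) ge; rewrite E ltnn.
Qed.

Lemma sum_level_sqr (B : nat) : (\sum_u k u ^ 2 <= 16 * N)%N ->
  \sum_(i < B) 16 ^+ i * #|level i|%:R <= 16 * N%:R :> R.
Proof.
rewrite -(ler_nat R) natr_sum natrM => kN; apply: (le_trans _ kN).
have E i : 16 ^+ i * #|level i|%:R = \sum_u (u \in level i)%:R * 16 ^+ i :> R.
  rewrite -mulr_suml mulrC -sum1_card natr_sum big_mkcond; congr (_ * _).
  by apply: eq_bigr => u _; case: (u \in _).
under [leLHS]eq_bigr do rewrite E.
rewrite exchange_big; apply: ler_sum => u _ /=.
apply: le_trans (sum_level B _ u _) _; first by move=> i; rewrite exprn_ge0.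
case: ifP => // ku; have /andP[h _] := trunc_log_bounds (isT : (1 < 4)%N) ku.
by rewrite (_ : 16 = (4 * 4)%N%:R) // -natrX ler_nat expnMn leq_mul.
Qed.

Lemma level_uniq (B : nat) u : \sum_(i < B) (u \in level i)%:R <= 1 :> R.
Proof.
rewrite (eq_bigr (fun i : 'I_B => (u \in level i)%:R * 1)); last by move=> i _; rewrite mulr1.
by apply: le_trans (sum_level B (fun=> 1) u _) _ => //; case: ifP.
Qed.

End Levels.

Section HeavyCouples.
Context (R : realType) (n m d1 d2 : nat).
Hypotheses (n_gt0 : (0 < n)%N) (m_gt0 : (0 < m)%N) (d1_gt0 : (0 < d1)%N) (d2_gt0 : (0 < d2)%N).
Hypotheses (edges : (n * d1 = m * d2)%N) (nm : (n <= m)%N).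
Local Notation Omega := (biregular n m d1 d2).
Local Notation p := (d2%:R / n%:R : R).

Lemma setstat_sum (S : {set 'I_n}) (T : {set 'I_m}) G :
  setstat R n m S T G = \sum_u (u \in S)%:R * \sum_v (v \in T)%:R * edge R n m G u v.
Proof.
by apply: eq_bigr => u _; rewrite mulr_sumr; apply: eq_bigr => v _; rewrite mulrA.
Qed.

Lemma setstat_sumr (S : {set 'I_n}) (T : {set 'I_m}) G :
  setstat R n m S T G = \sum_v (v \in T)%:R * \sum_u (u \in S)%:R * edge R n m G u v.
Proof.
rewrite /setstat /estat exchange_big; apply: eq_bigr => v _.
by rewrite mulr_sumr; apply: eq_bigr => u _; rewrite mulrA (mulrC (_ \in T)%:R).
Qed.

Lemma setstat_ge0 (S : {set 'I_n}) (T : {set 'I_m}) G : 0 <= setstat R n m S T G.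
Proof. by do 2![apply: sumr_ge0 => ? _]; rewrite !mulr_ge0 ?edge_ge0. Qed.

Lemma sum_mem (U : finType) (A : {set U}) : \sum_a (a \in A)%:R = #|A|%:R :> R.
Proof. by rewrite -sum1_card natr_sum [RHS]big_mkcond; apply: eq_bigr => a _; case: (a \in A). Qed.

Lemma sum_setstat_rows (B : nat) (S : {set 'I_n}) (l : 'I_m -> nat) G : G \in Omega ->
  \sum_(j < B) setstat R n m S (level m l j) G <= d1%:R * #|S|%:R.
Proof.
move=> GO; under eq_bigr do rewrite setstat_sum.
rewrite exchange_big -sum_mem mulr_sumr; apply: ler_sum => u _ /=.
rewrite -mulr_sumr mulrC ler_wpM2r // exchange_big -(row_sum R n m d1 d2 G u GO).
apply: ler_sum => v _ /=; rewrite -mulr_suml -[leRHS]mul1r.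
by rewrite ler_wpM2r ?edge_ge0 // level_uniq.
Qed.

Lemma sum_setstat_cols (B : nat) (k : 'I_n -> nat) (T : {set 'I_m}) G : G \in Omega ->
  \sum_(i < B) setstat R n m (level n k i) T G <= d2%:R * #|T|%:R.
Proof.
move=> GO; under eq_bigr do rewrite setstat_sumr.
rewrite exchange_big -sum_mem mulr_sumr; apply: ler_sum => v _ /=.
rewrite -mulr_sumr mulrC ler_wpM2r // exchange_big -(col_sum R n m d1 d2 G v GO).
apply: ler_sum => u _ /=; rewrite -mulr_suml -[leRHS]mul1r.
by rewrite ler_wpM2r ?edge_ge0 // level_uniq.
Qed.

(** The first product comes from level pairs with at most 16 times the mean count. The rest is two
    uses of [heavy_pairs] with [kappa = 32 c], each weighted by 16. *)
Definition heavy_const (c : R) : R := 1024 * 1024 + 32 * (528 + 384 * (32 * c)).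

(** On levels [i], [j] each value is below 4 times its power of 4, so [16 * (4^i * 4^j)] dominates
    the product, both as a weight and in the heaviness test. *)
Lemma heavy_le_levels (k : 'I_n -> nat) (l : 'I_m -> nat) (B : nat) (r : R) G :
  (forall u, (k u < B)%N) -> (forall v, (l v < B)%N) ->
  \sum_u \sum_v (if r < (k u * l v)%:R then (k u * l v)%:R * edge R n m G u v else 0) <=
  \sum_(i < B) \sum_(j < B) (if r < 16 * (4 ^+ i * 4 ^+ j)
    then 16 * (4 ^+ i * 4 ^+ j) * setstat R n m (level n k i) (level m l j) G else 0).
Proof.
move=> kB lB.
pose w (i j : nat) : R := if r < 16 * (4 ^+ i * 4 ^+ j) then 16 * (4 ^+ i * 4 ^+ j) else 0.
have w0 i j : 0 <= w i j by rewrite /w; case: ifP => // _; rewrite !mulr_ge0 ?exprn_ge0.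
have -> : \sum_(i < B) \sum_(j < B) (if r < 16 * (4 ^+ i * 4 ^+ j)
    then 16 * (4 ^+ i * 4 ^+ j) * setstat R n m (level n k i) (level m l j) G else 0) =
  \sum_u \sum_v \sum_(i < B) \sum_(j < B)
     w i j * ((u \in level n k i)%:R * (v \in level m l j)%:R * edge R n m G u v).
  under [RHS]eq_bigr do rewrite exchange_big /=.
  rewrite [RHS]exchange_big; apply: eq_bigr => i _ /=.
  under [RHS]eq_bigr do rewrite exchange_big /=.
  rewrite [RHS]exchange_big; apply: eq_bigr => j _ /=.
  rewrite /w /setstat /estat; case: ifP => _; last first.
    by rewrite big1 // => u _; rewrite big1 // => v _; rewrite mul0r.
  rewrite mulr_sumr; apply: eq_bigr => u _; by rewrite mulr_sumr.
apply: ler_sum => u _; apply: ler_sum => v _.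
have T0 i j : 0 <= w i j * ((u \in level n k i)%:R * (v \in level m l j)%:R * edge R n m G u v).
  by rewrite !mulr_ge0 ?edge_ge0.
case: ifP => rkl; last by do 2![apply: sumr_ge0 => ? _]; exact: T0.
have [k0|k0] := posnP (k u).
  by rewrite k0 mul0n mul0r; do 2![apply: sumr_ge0 => ? _]; exact: T0.
have [l0|l0] := posnP (l v).
  by rewrite l0 muln0 mul0r; do 2![apply: sumr_ge0 => ? _]; exact: T0.
have /andP[k1 k2] := trunc_log_bounds (isT : (1 < 4)%N) k0.
have /andP[l1 l2] := trunc_log_bounds (isT : (1 < 4)%N) l0.
set i0 := trunc_log 4 (k u) in k1 k2 *; set j0 := trunc_log 4 (l v) in l1 l2 *.
have i0B : (i0 < B)%N by apply: leq_trans (kB u); rewrite ltnS (leq_trans _ k1) // ltnW // ltn_expl.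
have j0B : (j0 < B)%N by apply: leq_trans (lB v); rewrite ltnS (leq_trans _ l1) // ltnW // ltn_expl.
rewrite (bigD1 (Ordinal i0B)) //= (bigD1 (Ordinal j0B)) //=.
rewrite -addrA; apply: ler_wpDr.
  by rewrite addr_ge0 //; [apply: sumr_ge0 => ? _|do 2![apply: sumr_ge0 => ? _]]; exact: T0.
rewrite !inE k0 l0 !eqxx !mul1r.
have kl : (k u * l v)%:R <= 16 * (4 ^+ i0 * 4 ^+ j0) :> R.
  rewrite -!natrX -!natrM ler_nat (leq_trans (leq_mul (ltnW k2) (ltnW l2))) //.
  by rewrite !expnS mulnACA.
by rewrite /w (lt_le_trans rkl kl) ler_wpM2r ?edge_ge0.
Qed.

(** Level pairs split in three. If the count is at most 16 times its mean, heaviness suffices.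
    Otherwise the absence of discrepancy bounds [e ln (e / mu)] by [16 c (entS + entT)], hence by
    [32 c] times one of the two entropies, and [heavy_pairs] applies on that side. *)
Lemma heavy_le (c : R) (k : 'I_n -> nat) (l : 'I_m -> nat) G : 0 <= c -> G \in Omega ->
  (forall S T, S != set0 -> T != set0 -> ~~ discrepant R n m d2 c S T G) ->
  (\sum_u k u ^ 2 <= 16 * n)%N -> (\sum_v l v ^ 2 <= 16 * m)%N ->
  \sum_u \sum_v (if Num.sqrt (d2%:R : R) < (k u * l v)%:R then (k u * l v)%:R * edge R n m G u v else 0)
    <= heavy_const c * (m%:R * Num.sqrt d2%:R).
Proof.
move=> c0 GO disc kn lm; set r := Num.sqrt (d2%:R : R); pose B := (16 * n + 16 * m).+1.
have r0 : 0 < r :> R by rewrite sqrtr_gt0 ltr0n.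
have rr : r * r = d2%:R :> R by rewrite -expr2 sqr_sqrtr.
have kB u : (k u < B)%N.
  rewrite ltnS (leq_trans _ (leq_addr _ _)) // (leq_trans _ kn) // (bigD1 u) //=.
  by rewrite (leq_trans _ (leq_addr _ _)) //; case: (k u) => // a; rewrite leq_pmulr.
have lB v : (l v < B)%N.
  rewrite ltnS (leq_trans _ (leq_addl _ _)) // (leq_trans _ lm) // (bigD1 v) //=.
  by rewrite (leq_trans _ (leq_addr _ _)) //; case: (l v) => // a; rewrite leq_pmulr.
apply: le_trans (heavy_le_levels k l B r G kB lB) _.
pose s i : R := #|level n k i|%:R; pose t j : R := #|level m l j|%:R.
pose e i j := setstat R n m (level n k i) (level m l j) G.
pose mu i j := p * (s i * t j).
pose entS i := entropy R n #|level n k i|; pose entT j := entropy R m #|level m l j|.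
pose big i j := 16 * mu i j <= e i j.
pose typeT i j := e i j * ln (e i j / mu i j) <= 32 * c * entT j.
pose eT i j := if big i j && typeT i j then e i j else 0.
pose eS i j := if big i j && ~~ typeT i j then e i j else 0.
have e0 i j : 0 <= e i j by exact: setstat_ge0.
have s0 i : 0 <= s i by []. have t0 j : 0 <= t j by [].
have N0 : 0 < n%:R :> R by rewrite ltr0n.
have M0 : 0 < m%:R :> R by rewrite ltr0n.
have D0 : 0 < d2%:R :> R by rewrite ltr0n.
have p0 : 0 < p by rewrite divr_gt0.
have P4 (i : nat) : 0 <= 4 ^+ i :> R by rewrite exprn_ge0.
have sn := sum_level_sqr R n k B kn; have tm := sum_level_sqr R m l B lm.
have nd : n%:R * d1%:R = m%:R * d2%:R :> R by rewrite -!natrM edges.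
have e_empty i j : e i j != 0 -> (0 < #|level n k i|)%N /\ (0 < #|level m l j|)%N.
  move=> en; split; rewrite card_gt0; apply: contraNneq en; rewrite /e setstat_sum => ->.
    by rewrite big1 // => u _; rewrite inE mul0r.
  by rewrite big1 // => u _; rewrite big1 ?mulr0 // => v _; rewrite inE mul0r.
have cardn i : (#|level n k i| <= n)%N by rewrite -[X in (_ <= X)%N](card_ord n) max_card.
have cardm j : (#|level m l j| <= m)%N by rewrite -[X in (_ <= X)%N](card_ord m) max_card.
have HT : \sum_(i < B) \sum_(j < B) 4 ^+ i * 4 ^+ j * eT i j <=
    (528 + 384 * (32 * c)) * (m%:R * r).
  apply: (heavy_pairs R B B s t eT n%:R m%:R m%:R d1%:R d2%:R p (32 * c)) => //.
  - exact: ltW.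
  - by rewrite mulr_ge0.
  - by move=> i j; rewrite /eT; case: ifP.
  - move=> i; apply: le_trans (sum_setstat_rows B _ l _ GO).
    by apply: ler_sum => j _; rewrite /eT; case: ifP => // _; exact: e0.
  - move=> i j; rewrite /eT; case: ifP => [/andP[h1 h2]|_]; last by left.
    have [->|en] := eqVneq (e i j) 0; first by left.
    have [S0 T0] := e_empty _ _ en.
    by right; split; [split; rewrite ?ltr0n ?ler_nat|..].
  - by rewrite divfK ?gt_eqF.
  - by rewrite mulrC nd.
have HS : \sum_(j < B) \sum_(i < B) 4 ^+ j * 4 ^+ i * eS i j <=
    (528 + 384 * (32 * c)) * (m%:R * r).
  apply: (heavy_pairs R B B t s (fun j i => eS i j) m%:R n%:R m%:R d2%:R d2%:R p (32 * c)) => //.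
  - exact: ltW.
  - by rewrite mulr_ge0.
  - by move=> i j; rewrite /eS; case: ifP.
  - move=> j; apply: le_trans (sum_setstat_cols B k _ _ GO).
    by apply: ler_sum => i _; rewrite /eS; case: ifP => // _; exact: e0.
  - move=> j i; rewrite /eS; case: ifP => [/andP[h1 h2]|_]; last by left.
    have [->|en] := eqVneq (e i j) 0; first by left.
    have [S0 T0] := e_empty _ _ en.
    right; split=> //; first by split; rewrite ?ltr0n ?ler_nat.
      by rewrite (mulrC (t j)).
    have := disc (level n k i) (level m l j); rewrite -!card_gt0 => /(_ S0 T0).
    rewrite /discrepant negb_and -/(e i j) -[setmean _ _ _ _ _ _]/(mu i j) [_ <= e i j]h1 /= -leNgt.
    move: h2; rewrite /typeT -ltNge -/(entS i) -/(entT j) (mulrC (t j)) -/(mu i j).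
    rewrite -[s i * _]/(entS i); set x := e i j * _; lra.
  - by rewrite mulrAC divfK ?gt_eqF.
  - by rewrite ler_nat.
  - by rewrite mulrC.
(* Here [4 * 1024 = 16^3]: the weight, the bound by 16 times the mean, and an extra factor
   [16 * (4^i * 4^j) / r], at least 1 by heaviness, which creates the squares controlled by the
   level sizes. *)
have HA : \sum_(i < B) \sum_(j < B) 4 * 1024 * p / r * ((16 ^+ i * s i) * (16 ^+ j * t j)) <=
   1024 * 1024 * (m%:R * r).
  under eq_bigr do rewrite -!mulr_sumr.
  rewrite -mulr_sumr -mulr_suml.
  apply: (@le_trans _ _ (4 * 1024 * p / r * ((16 * n%:R) * (16 * m%:R)))).
    rewrite ler_wpM2l ?divr_ge0 ?mulr_ge0 ?invr_ge0 ?(ltW p0) ?(ltW r0) //.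
    by apply: ler_pM => //; apply: sumr_ge0 => i _; rewrite mulr_ge0 ?exprn_ge0.
  rewrite le_eqVlt; apply/orP; left; apply/eqP.
  by rewrite -rr; field; rewrite !gt_eqF.
apply: (@le_trans _ _ (\sum_(i < B) \sum_(j < B) (4 * 1024 * p / r * ((16 ^+ i * s i) * (16 ^+ j * t j))
   + 16 * (4 ^+ i * 4 ^+ j * eT i j) + 16 * (4 ^+ j * 4 ^+ i * eS i j)))).
  apply: ler_sum => i _; apply: ler_sum => j _; rewrite -/(e i j).
  have h1 : 0 <= 4 * 1024 * p / r * ((16 ^+ i * s i) * (16 ^+ j * t j)).
    by rewrite !mulr_ge0 ?invr_ge0 ?exprn_ge0 ?(ltW p0) ?(ltW r0) ?(ltW N0).
  have h2 : 0 <= 16 * (4 ^+ i * 4 ^+ j * eT i j) by rewrite !mulr_ge0 // /eT; case: ifP.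
  have h3 : 0 <= 16 * (4 ^+ j * 4 ^+ i * eS i j) by rewrite !mulr_ge0 // /eS; case: ifP.
  case: ifP => [rlt|_]; last by rewrite !addr_ge0.
  have [hb|hb] := boolP (big i j); last first.
    have emu : e i j <= 16 * mu i j by rewrite ltW // ltNge.
    rewrite -addrA; apply: ler_wpDr; first by rewrite addr_ge0.
    set x := 4 ^+ i * 4 ^+ j in rlt *.
    have x0 : 0 <= x by rewrite mulr_ge0.
    apply: (@le_trans _ _ (16 * x * (16 * mu i j))); first by rewrite ler_wpM2l ?mulr_ge0.
    apply: (@le_trans _ _ (16 * x * (16 * mu i j) * (16 * x / r))).
      rewrite ler_peMr ?ler_pdivlMr ?mul1r ?(ltW rlt) // !mulr_ge0 ?invr_ge0 // ltW //.
    rewrite le_eqVlt; apply/orP; left; apply/eqP.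
    have E (a : nat) : 16 ^+ a = 4 ^+ a * 4 ^+ a :> R by rewrite -exprMn; congr (_ ^+ _); ring.
    by rewrite !E /x /mu; field; rewrite !gt_eqF.
  rewrite /eT /eS hb /= in h2 h3 *; case: (typeT i j) h2 h3 => /= h2 h3.
    rewrite -(mulrA 16) mulr0 mulr0; lra.
  by rewrite -(mulrA 16) (mulrC (4 ^+ j)) mulr0 mulr0; lra.
have E1 : \sum_(i < B) \sum_(j < B) 16 * (4 ^+ i * 4 ^+ j * eT i j) =
    16 * \sum_(i < B) \sum_(j < B) 4 ^+ i * 4 ^+ j * eT i j.
  by rewrite mulr_sumr; apply: eq_bigr => i _; rewrite mulr_sumr.
have E2 : \sum_(i < B) \sum_(j < B) 16 * (4 ^+ j * 4 ^+ i * eS i j) =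
    16 * \sum_(j < B) \sum_(i < B) 4 ^+ j * 4 ^+ i * eS i j.
  by rewrite exchange_big mulr_sumr; apply: eq_bigr => i _; rewrite mulr_sumr.
under eq_bigr do rewrite !big_split /=.
rewrite !big_split /= E1 E2.
rewrite /heavy_const [leRHS](_ : _ = 1024 * 1024 * (m%:R * r) + 16 * ((528 + 384 * (32 * c)) * (m%:R * r))
  + 16 * ((528 + 384 * (32 * c)) * (m%:R * r))); last by ring.
by apply: lerD; [apply: lerD|]; rewrite // ler_wpM2l.
Qed.

End HeavyCouples.

(** * The second eigenvalue as a quadratic form *)

Section SecondEigenvalue.
Local Open Scope sesquilinear_scope.
Context (R : realType) (N : nat) (A : 'M[R]_N).
Hypothesis symA : A^T = A.
Let f := real_complex R.
Let B : 'M[R[i]]_N := map_mx f A.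

(** The spectral theorem is applied to the complexification, whose eigenvalues are real; the
    characteristic polynomial identifies them with [spectrum A]. *)
Lemma spectral_decomposition : exists (P : 'M[R[i]]_N) (d : 'I_N -> R),
  [/\ P *m P ^t* = 1%:M, B = P ^t* *m diag_mx (\row_j f (d j)) *m P &
      perm_eq (spectrum A) [seq d j | j <- enum 'I_N]].
Proof.
have hB : B \is hermsymmx.
  apply: realsym_hermsym.
    by apply/is_hermitianmxP; rewrite expr0 scale1r map_mx_id // /B map_trmx symA.
  apply/mxOverP => i j; rewrite mxE; apply/complex_realP; by exists (A i j).
have rD := hermitian_spectral_diag_real hB.
have /orthomx_spectralP EB := hermitian_normalmx hB.
pose d j := complex.Re (spectral_diag B 0 j).
have dE : spectral_diag B = \row_j f (d j).
  apply/rowP => j; rewrite mxE.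
  by rewrite /d; have /mxOverP/(_ 0 j)/complex_realP[k ->] := rD.
have uP := spectral_unitarymx B.
exists (spectralmx B), d; split.
- exact/unitarymxP.
- by rewrite -invmx_unitary // -dE.
have cpB : char_poly A = \prod_j ('X - (d j)%:P).
  apply: (map_poly_inj f); rewrite map_char_poly rmorph_prod -/B.
  have -> : char_poly B = char_poly (diag_mx (spectral_diag B)).
    have uu := spectral_unit B.
    move: EB uu; set P := spectralmx B => EB uu.
    rewrite /char_poly /char_poly_mx {1}EB !map_mxM /=.
    set Q := map_mx _ (invmx P); set S := map_mx _ P; set D := map_mx _ (diag_mx _).
    have QS : Q *m S = 1%:M by rewrite -map_mxM mulVmx // map_mx1.
    have -> : 'X%:M - Q *m D *m S = Q *m ('X%:M - D) *m S.
      by rewrite mulmxBr mulmxBl scalar_mxC -(mulmxA _ Q S) QS mulmx1.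
    by rewrite !det_mulmx mulrAC -det_mulmx QS det1 mul1r.
  rewrite char_poly_trig ?diag_mx_is_trig //; apply: eq_bigr => j _.
  by rewrite dE !mxE eqxx mulr1n rmorphB /= map_polyX map_polyC.
have [_ cpA] := spectrumP symA.
by apply: prod_XsubC_eq; rewrite -cpA cpB big_map big_enum.
Qed.

(** By symmetry the cross terms between real and imaginary parts cancel, so bounds on real vectors
    pass to complex eigenvectors. *)
Lemma hermitian_form_split (M : 'M[R]_N) (a b : 'rV[R]_N) : M^T = M ->
  let z := map_mx f a + 'i *: map_mx f b in
  z *m map_mx f M *m z ^t* = map_mx f (a *m M *m a^T + b *m M *m b^T).
Proof.
move=> symM z.
have zE : z ^t* = (map_mx f a)^T - 'i *: (map_mx f b)^T.
  apply/colP => k; rewrite !mxE rmorphD rmorphM /= conjCi mulNr.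
  by congr (_ - _ * _); exact: conjc_real.
have cross : b *m M *m a^T = a *m M *m b^T.
  have <- : (b *m M *m a^T)^T = a *m M *m b^T by rewrite !trmx_mul trmxK symM mulmxA.
  by apply/matrixP => i j; rewrite !ord1 [RHS]mxE.
rewrite zE /z !mulmxDl !mulmxBr -!scalemxAl -!scalemxAr. rewrite !map_trmx -!map_mxM cross.
by rewrite scalerA -expr2 sqrCi scaleN1r opprK [RHS]map_mxD addrA subrK.
Qed.

Lemma complex_row_split (z : 'rV[R[i]]_N) : \sum_k z 0 k = 0 ->
  exists a b : 'rV[R]_N, [/\ z = map_mx f a + 'i *: map_mx f b,
    \sum_k a 0 k = 0 & \sum_k b 0 k = 0].
Proof.
move=> z0; pose a := \row_k complex.Re (z 0 k); pose b := \row_k complex.Im (z 0 k).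
have zab : z = map_mx f a + 'i *: map_mx f b.
  by apply/rowP => k; rewrite !mxE -complexiE -complexE.
exists a, b; move: z0; rewrite zab; move: a b {zab} => a b.
have E k : (map_mx f a + 'i *: map_mx f b) 0 k = f (a 0 k) + 'i * f (b 0 k) by rewrite !mxE.
under eq_bigr do rewrite E.
rewrite big_split -mulr_sumr -!rmorph_sum /= -complexiE; set x := \sum_k _; set y := \sum_k _.
by move/eqP; rewrite eq_complex /= !(mul0r, mul1r, mulr0, addr0, add0r, subr0) => /andP[/eqP x0 /eqP y0].
Qed.

(** Courant-Fischer: if two eigenvalues exceeded [sigma], the plane of their eigenvectors would meet
    the hyperplane of zero sum in a nonzero vector violating the bound. *)
Lemma eig2_le_form (sigma : R) : 0 <= sigma ->
  (forall z : 'rV[R]_N, \sum_k z 0 k = 0 ->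
     (z *m A *m z^T) 0 0 <= sigma * (z *m z^T) 0 0) ->
  eig A 2 <= sigma.
Proof.
move=> s0 form; rewrite leNgt; apply/negP; rewrite /eig /= => gt.
have [P [d [PP EB pd]]] := spectral_decomposition.
have [sorted_s _] := spectrumP symA.
(* For a spectrum with fewer than two entries [nth] returns 0, and [0 <= sigma] excludes this
   case. *)
have two : (1 < count (fun x : R => (sigma < x)%R) (spectrum A))%N.
  case: (spectrum A) gt sorted_s => [|x [|y s]] /=; [by rewrite ltNge s0|by rewrite ltNge s0|].
  by move=> gy; case/andP=> yx _; rewrite gy (lt_le_trans gy yx).
have /card_gt1P[i [j [di dj ij]]] : (1 < #|[pred j | (sigma < d j)%R]|)%N.
  apply: leq_trans two _; rewrite (permP pd) count_map cardE size_filter.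
  by rewrite -enumT; apply: eq_leq; apply: eq_count.
rewrite !inE in di dj.
(* These coefficients cancel the coordinate sums of the two rows; when both vanish, the row [i]
   alone has zero sum. *)
pose c1 := \sum_k P j k; pose c2 := - \sum_k P i k.
have [c [c0 cz]] : exists c : R[i] * R[i], (c.1 != 0) || (c.2 != 0) /\
    \sum_k (c.1 * P i k + c.2 * P j k) = 0.
  have [e|ne] := boolP ((c1 == 0) && (c2 == 0)).
    exists (1, 0); rewrite oner_neq0; split=> //.
    have /andP[_ /eqP e2] := e.
    under eq_bigr do rewrite /= mul1r mul0r addr0.
    by apply/eqP; rewrite -oppr_eq0; apply/eqP.
  exists (c1, c2); rewrite -negb_and; split=> //=.
  by rewrite big_split -!mulr_sumr /= /c1 /c2; ring.
pose w : 'rV[R[i]]_N := \row_k (if k == i then c.1 else if k == j then c.2 else 0).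
pose z := w *m P.
have z0 : \sum_k z 0 k = 0.
  rewrite -[RHS]cz; apply: eq_bigr => k _; rewrite !mxE (bigD1 i) //= (bigD1 j) /=; last first.
    by rewrite eq_sym.
  rewrite !mxE eqxx (eq_sym j) (negbTE ij) eqxx big1 ?addr0 // => l /andP[li lj].
  by rewrite !mxE (negbTE li) (negbTE lj) mul0r.
have [a [b [zab a0 b0]]] := complex_row_split z z0.
have E1 := hermitian_form_split A a b symA; rewrite /= -zab -/B in E1.
have E2 := hermitian_form_split 1%:M a b (trmx1 _ _); rewrite /= -zab map_mx1 in E2.
have wf (D : 'M[R[i]]_N) : z *m (P ^t* *m D *m P) *m z ^t* = w *m D *m w ^t*.
  rewrite /z trmx_mul map_mxM /= !mulmxA -(mulmxA w P) PP mulmx1.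
  by rewrite -(mulmxA (w *m D)) PP mulmx1.
have PP' : P ^t* *m 1%:M *m P = 1%:M by rewrite mulmx1; exact: mulmx1C.
have le : (w *m diag_mx (\row_k f (d k)) *m w ^t*) 0 0 <= f sigma * (w *m 1%:M *m w ^t*) 0 0.
  rewrite -!wf -EB PP' E1 E2 !mulmx1 !mxE -rmorphM lecR.
  have := form a a0; have := form b b0; rewrite !mxE; lra.
have E (v : 'rV[R[i]]_N) : (w *m diag_mx v *m w ^t*) 0 0 = \sum_k v 0 k * `|w 0 k| ^+ 2.
  rewrite mxE; apply: eq_bigr => k _; rewrite mul_mx_diag !mxE normCK; ring.
move: le; rewrite -diag_const_mx !E mulr_sumr -subr_le0 -sumrB.
apply/negP; set total := \sum_k _; suff total_gt0 : 0 < total by rewrite (lt_geF total_gt0).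
rewrite /total.
have pos k : 0 <= (\row_k f (d k)) 0 k * `|w 0 k| ^+ 2 - f sigma * (const_mx 1 0 k * `|w 0 k| ^+ 2).
  rewrite !mxE mul1r -mulrBl; case: eqP => [->|_]; last case: eqP => [->|_].
  - by rewrite mulr_ge0 ?exprn_ge0 // subr_ge0 lecR ltW.
  - by rewrite mulr_ge0 ?exprn_ge0 // subr_ge0 lecR ltW.
  - by rewrite normr0 expr0n mulr0.
have posk k : (k == i) || (k == j) -> w 0 k != 0 ->
    0 < (\row_k f (d k)) 0 k * `|w 0 k| ^+ 2 - f sigma * (const_mx 1 0 k * `|w 0 k| ^+ 2).
  move=> kij wk; rewrite [X in X * _ - _]mxE [X in _ - _ * (X * _)]mxE mul1r -mulrBl mulr_gt0 //.
    by rewrite subr_gt0 ltcR; case/orP: kij => /eqP ->.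
  by rewrite exprn_gt0 // normr_gt0.
have [k kij wk] : exists2 k, (k == i) || (k == j) & w 0 k != 0.
  case/orP: c0 => h; first by exists i; rewrite ?eqxx // mxE eqxx.
  by exists j; rewrite ?eqxx ?orbT // mxE (eq_sym j i) (negbTE ij) eqxx.
rewrite (bigD1 k) //=; apply: ltr_wpDr; last exact: posk.
by apply: sumr_ge0 => l _; exact: pos.
Qed.

End SecondEigenvalue.

Lemma eig2_adj_le (R : realType) (n m : nat) (G : bigraph n m) (sigma : R) : 0 <= sigma ->
  (forall (x : 'I_n -> R) (y : 'I_m -> R), (\sum_u x u) * (\sum_v y v) <= 0 ->
    \sum_u \sum_v x u * y v * ((u, v) \in G)%:R <=
      sigma / 2 * (\sum_u x u ^+ 2 + \sum_v y v ^+ 2)) ->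
  eig (adj_mx R G) 2 <= sigma.
Proof.
move=> s0 form; apply: eig2_le_form => //; first exact: adj_mx_sym.
move=> z z0; pose x u := lsubmx z 0 u; pose y v := rsubmx z 0 v.
have zxy : z = row_mx (lsubmx z) (rsubmx z) by rewrite hsubmxK.
have sxy : \sum_u x u + \sum_v y v = 0.
  by rewrite -[RHS]z0 big_split_ord /=; congr (_ + _); apply: eq_bigr => k _; rewrite ?/x ?/y mxE.
have xy0 : (\sum_u x u) * (\sum_v y v) <= 0.
  have -> : \sum_v y v = - \sum_u x u by apply/eqP; rewrite -addr_eq0 addrC sxy.
  by rewrite mulrN oppr_le0 -expr2 sqr_ge0.
have zz : (z *m z^T) 0 0 = \sum_u x u ^+ 2 + \sum_v y v ^+ 2.
  by rewrite zxy tr_row_mx mul_row_col mxE; congr (_ + _); rewrite mxE;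
    apply: eq_bigr => k _; rewrite ?/x ?/y !mxE expr2.
have zAz : (z *m adj_mx R G *m z^T) 0 0 = 2 * \sum_u \sum_v x u * y v * ((u, v) \in G)%:R.
  rewrite zxy tr_row_mx /adj_mx mul_row_block !mulmx0 add0r addr0 mul_row_col.
  set S := \sum_u _.
  have E1 : (lsubmx z *m biadj_mx R G *m (rsubmx z)^T) 0 0 = S.
    rewrite mxE /S exchange_big; apply: eq_bigr => v _; rewrite !mxE mulr_suml.
    by apply: eq_bigr => u _; rewrite !mxE /x /y !mxE; ring.
  have <- : (lsubmx z *m biadj_mx R G *m (rsubmx z)^T)^T = rsubmx z *m (biadj_mx R G)^T *m (lsubmx z)^T.
    by rewrite !trmx_mul trmxK mulmxA.
  by rewrite mxE [X in X + _]mxE E1; ring.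
by rewrite zAz zz; have := form x y xy0; lra.
Qed.

(** * From grid vectors to all vectors *)

(** Rounding [4 sqrt n |x u|] down keeps the vector in the ball and costs at most [1 / (4 sqrt n)]
    per coordinate, hence at most 1/4 in norm. *)
Lemma grid_approx (R : realType) (n : nat) (x : 'I_n -> R) : (0 < n)%N ->
  \sum_u x u ^+ 2 <= 1 ->
  exists2 k : grid n, gball n k & 
    (forall u, (gval R n k u / (4 * Num.sqrt n%:R)) ^+ 2 <= x u ^+ 2) /\
    (forall u, (x u - gval R n k u / (4 * Num.sqrt n%:R)) ^+ 2 <= (16 * n%:R)^-1).
Proof.
move=> n0 x1; set s := Num.sqrt n%:R.
have N0 : 0 < n%:R :> R by rewrite ltr0n.
have ss : s ^+ 2 = n%:R by rewrite sqr_sqrtr // ltW.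
have s1 : 1 <= s by rewrite -sqrtr1 ler_wsqrtr // ler1n.
have s0 : 0 < 4 * s by lra.
have xle u : `|x u| <= 1.
  rewrite -(ler_pXn2r (n := 2)) ?nnegrE // expr1n -normrX ger0_norm ?sqr_ge0 //.
  by apply: le_trans x1; rewrite (bigD1 u) //= lerDl sumr_ge0 // => i _; exact: sqr_ge0.
pose t u := Num.truncn (4 * s * `|x u|).
have tP u : (t u)%:R <= 4 * s * `|x u| < (t u).+1%:R.
  by apply: truncn_itv; rewrite mulr_ge0 // ltW.
have t4n u : (t u < (4 * n).+1)%N.
  rewrite ltnS -(ler_nat R) natrM; have /andP[h _] := tP u; apply: le_trans h _.
  have := xle u; rewrite -ss; nra.
pose k : grid n := [ffun u => (x u < 0, inord (t u))].
have gk u : gabs n k u = t u by rewrite /gabs ffunE /= inordK.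
have kv u : gval R n k u / (4 * s) = (-1) ^+ (x u < 0)%R * ((t u)%:R / (4 * s)).
  by rewrite /gval gk ffunE /= mulrA.
have sgn (b : bool) (a : R) : ((-1) ^+ b * a) ^+ 2 = a ^+ 2.
  by rewrite exprMn -exprM mulnC exprM sqrrN !expr1n mul1r.
have ts u : (t u)%:R / (4 * s) <= `|x u| by rewrite ler_pdivrMr // mulrC; case/andP: (tP u).
have ts0 u : 0 <= (t u)%:R / (4 * s) by rewrite divr_ge0 // ltW.
have sqle u : ((t u)%:R / (4 * s)) ^+ 2 <= x u ^+ 2.
  by rewrite -[leRHS]ger0_norm ?sqr_ge0 // normrX lerXn2r ?nnegrE.
exists k; last split.
- rewrite /gball -(ler_nat R) natr_sum natrM.
  apply: (@le_trans _ _ (\sum_u 16 * n%:R * x u ^+ 2)); last first.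
    by rewrite -mulr_sumr -[leRHS]mulr1 ler_wpM2l // mulr_ge0 // ltW.
  apply: ler_sum => u _; rewrite gk natrX -ss.
  rewrite (_ : (t u)%:R ^+ 2 = 16 * s ^+ 2 * ((t u)%:R / (4 * s)) ^+ 2).
    by rewrite ler_wpM2l ?sqle // mulr_ge0 ?sqr_ge0.
  by field; lra.
- by move=> u; rewrite kv sgn.
- move=> u; rewrite kv {1}[x u]realEsign ?num_real // -mulrBr sgn.
  have h : `|x u| - (t u)%:R / (4 * s) <= (4 * s)^-1.
    rewrite lerBlDr -[X in X + _]mul1r -mulrDl ler_pdivlMr // mulrC.
    by rewrite addrC natr1 ltW //; case/andP: (tP u).
  rewrite (_ : (16 * n%:R)^-1 = (4 * s)^-1 ^+ 2); last by rewrite -ss; field; lra.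
  by rewrite lerXn2r ?nnegrE ?invr_ge0 ?subr_ge0 // ltW.
Qed.

(** Let [S] be the supremum of the form over unit balls. Rounding both arguments leaves a grid value
    and two errors of at most [S / 4], so [S <= L + S / 2], that is [S <= 2 L]; homogeneity and
    AM-GM conclude. *)
Lemma bilinear_le_grid (R : realType) (n m : nat) (M : 'I_n -> 'I_m -> R) (L : R) :
  (0 < n)%N -> (0 < m)%N ->
  (forall (k : grid n) (l : grid m), gball n k -> gball m l ->
     \sum_u \sum_v gval R n k u * gval R m l v * M u v <=
       L * (16 * (Num.sqrt n%:R * Num.sqrt m%:R))) ->
  forall x y, \sum_u \sum_v x u * y v * M u v <= L * (\sum_u x u ^+ 2 + \sum_v y v ^+ 2).
Proof.
move=> n0 m0 onGrid.
have sn0 : 0 < Num.sqrt n%:R :> R by rewrite sqrtr_gt0 ltr0n.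
have sm0 : 0 < Num.sqrt m%:R :> R by rewrite sqrtr_gt0 ltr0n.
pose b x y : R := \sum_u \sum_v x u * y v * M u v.
have bDl x x' y : b (fun u => x u + x' u) y = b x y + b x' y.
  rewrite -big_split; apply: eq_bigr => u _; rewrite -big_split; apply: eq_bigr => v _ /=; ring.
have bDr x y y' : b x (fun v => y v + y' v) = b x y + b x y'.
  rewrite -big_split; apply: eq_bigr => u _; rewrite -big_split; apply: eq_bigr => v _ /=; ring.
have bZ c c' x y : b (fun u => c * x u) (fun v => c' * y v) = c * c' * b x y.
  rewrite mulr_sumr; apply: eq_bigr => u _; rewrite mulr_sumr; apply: eq_bigr => v _; ring.
pose E (z : R) : Prop := exists x y, [/\ \sum_u x u ^+ 2 <= 1, \sum_v y v ^+ 2 <= 1 & z = b x y].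
have E0 : E (b (fun=> 0) (fun=> 0)).
  by exists (fun=> 0), (fun=> 0); split=> //; rewrite big1 // => i _; rewrite expr0n.
have small (N : nat) (x : 'I_N -> R) u : \sum_u x u ^+ 2 <= 1 -> `|x u| <= 1.
  move=> x1; rewrite -(ler_pXn2r (n := 2)) ?nnegrE // expr1n -normrX ger0_norm ?sqr_ge0 //.
  by apply: le_trans x1; rewrite (bigD1 u) //= lerDl sumr_ge0 // => i _; exact: sqr_ge0.
(* Finiteness of the supremum is what allows [S <= L + S / 2] to be solved for [S]. *)
have Eub : classical_sets.has_ubound E.
  exists (\sum_u \sum_v `|M u v|) => z [x [y [x1 y1 ->]]].
  apply: ler_sum => u _; apply: ler_sum => v _; apply: le_trans (ler_norm _) _.
  rewrite !normrM -[leRHS]mul1r ler_wpM2r // -[leRHS]mulr1.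
  by apply: ler_pM => //; exact: small.
set S := sup E.
have SP x y : \sum_u x u ^+ 2 <= 1 -> \sum_v y v ^+ 2 <= 1 -> b x y <= S.
  by move=> x1 y1; apply: (ub_le_sup Eub); exists x, y.
have err (N : nat) (x x' : 'I_N -> R) : (0 < N)%N ->
    (forall u, (x u - x' u) ^+ 2 <= (16 * N%:R)^-1) -> \sum_u (4 * (x u - x' u)) ^+ 2 <= 1.
  move=> N0 h; apply: (@le_trans _ _ (\sum_(u < N) 16 * (16 * N%:R)^-1)).
    apply: ler_sum => u _; rewrite exprMn (_ : 4 ^+ 2 = 16); last by ring.
    by rewrite ler_wpM2l.
  rewrite sumr_const card_ord -[leLHS]mulr_natl le_eqVlt; apply/orP; left; apply/eqP.
  by field; rewrite gt_eqF ?ltr0n.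
have Sle : S <= L + S / 2.
  apply: ge_sup; first by exists (b (fun=> 0) (fun=> 0)).
  move=> z [x [y [x1 y1 ->]]].
  have [k kb [kx kerr]] := grid_approx R n x n0 x1.
  have [l lb [ly lerr]] := grid_approx R m y m0 y1.
  set x' := fun u => gval R n k u / (4 * Num.sqrt n%:R) in kx kerr.
  set y' := fun v => gval R m l v / (4 * Num.sqrt m%:R) in ly lerr.
  have x'1 : \sum_u x' u ^+ 2 <= 1 by apply: le_trans x1; apply: ler_sum => u _; exact: kx.
  have -> : b x y = b x' y' + 4^-1 * b (fun u => 4 * (x u - x' u)) y
     + 4^-1 * b x' (fun v => 4 * (y v - y' v)).
    rewrite /b !mulr_sumr -!big_split; apply: eq_bigr => u _ /=.
    by rewrite !mulr_sumr -!big_split; apply: eq_bigr => v _ /=; field.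
  have h1 : b (fun u => 4 * (x u - x' u)) y <= S by apply: SP => //; exact: err.
  have h2 : b x' (fun v => 4 * (y v - y' v)) <= S by apply: SP => //; exact: err.
  have h3 : b x' y' <= L.
    have := onGrid k l kb lb.
    set g := \sum_u _; have -> : g = 16 * (Num.sqrt n%:R * Num.sqrt m%:R) * b x' y'.
      rewrite /g /b mulr_sumr; apply: eq_bigr => u _; rewrite mulr_sumr; apply: eq_bigr => v _.
      by rewrite /x' /y'; field; rewrite !gt_eqF.
    by rewrite mulrC ler_pM2r // !mulr_gt0.
  by lra.
have S2L : S <= 2 * L by lra.
have L0 : 0 <= L.
  have := ub_le_sup Eub E0; rewrite -/S /b big1; first by lra.
  by move=> u _; rewrite big1 // => v _; rewrite !mul0r.
move=> x y; rewrite -/(b x y).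
set X := \sum_u _; set Y := \sum_v _.
have X0 : 0 <= X by apply: sumr_ge0 => u _; exact: sqr_ge0.
have Y0 : 0 <= Y by apply: sumr_ge0 => u _; exact: sqr_ge0.
have norm0 (N : nat) (w : 'I_N -> R) : \sum_i w i ^+ 2 = 0 -> forall i, w i = 0.
  move=> w0 i; apply/eqP; rewrite -sqrf_eq0.
  have /psumr_eq0P := w0 => -> // j _; exact: sqr_ge0.
have [X00|Xn] := eqVneq X 0.
  rewrite /b big1 ?mulr_ge0 ?addr_ge0 // => u _; rewrite big1 // => v _.
  by rewrite (norm0 _ _ X00) !mul0r.
have [Y00|Yn] := eqVneq Y 0.
  rewrite /b big1 ?mulr_ge0 ?addr_ge0 // => u _; rewrite big1 // => v _.
  by rewrite (norm0 _ _ Y00) mulr0 mul0r.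
have sX : 0 < Num.sqrt X by rewrite sqrtr_gt0 lt_def Xn.
have sY : 0 < Num.sqrt Y by rewrite sqrtr_gt0 lt_def Yn.
have XX : Num.sqrt X ^+ 2 = X by rewrite sqr_sqrtr.
have YY : Num.sqrt Y ^+ 2 = Y by rewrite sqr_sqrtr.
have unit1 : \sum_u ((Num.sqrt X)^-1 * x u) ^+ 2 <= 1.
  by under eq_bigr do rewrite exprMn; rewrite -mulr_sumr -/X exprVn XX mulVf.
have unit2 : \sum_v ((Num.sqrt Y)^-1 * y v) ^+ 2 <= 1.
  by under eq_bigr do rewrite exprMn; rewrite -mulr_sumr -/Y exprVn YY mulVf.
have := SP _ _ unit1 unit2; rewrite bZ -invfM ler_pdivrMl ?mulr_gt0 // => h.
apply: le_trans h _; apply: (@le_trans _ _ (Num.sqrt X * Num.sqrt Y * (2 * L))).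
  by rewrite ler_wpM2l // mulr_ge0 // ltW.
rewrite -{2}XX -{2}YY; have := sqr_ge0 (Num.sqrt X - Num.sqrt Y); nra.
Qed.

(** * Biregular graphs *)

(** Cyclic construction: [u] is joined to the residues mod [m] of the [d1] integers from [u d1] on.
    These are distinct since [d1 <= m]. The blocks tile the integers below [m d2], where [v] is hit
    by the [d2] numbers [v + m s]; their gaps are at least [d1], so they lie in distinct blocks. *)
Lemma biregular_neq0 (n m d1 d2 : nat) : (0 < m)%N -> (0 < d1)%N ->
  (n * d1 = m * d2)%N -> (d1 <= m)%N -> biregular n m d1 d2 != set0.
Proof.
move=> m0 d10 edges d1m.
pose G : bigraph n m := [set e : 'I_n * 'I_m | [exists t : 'I_d1, ((e.1 * d1 + t) %% m == e.2)%N]]%SET.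
apply/set0Pn; exists G; rewrite inE; apply/andP; split; [apply/forallP => u|apply/forallP => v]; apply/eqP.
  pose f (t : 'I_d1) : 'I_m := Ordinal (ltn_pmod (u * d1 + t) m0).
  have finj : injective f.
    move=> t t' /(congr1 val) /= /eqP; rewrite eqn_modDl !modn_small ?(leq_trans (ltn_ord _)) //.
    by move=> /eqP/val_inj.
  rewrite -[RHS](card_ord d1) -(card_codom finj); apply: eq_card => v; rewrite !inE /=.
  apply/existsP/codomP => [[t /eqP e]|[t ->]]; exists t => //.
  by apply: val_inj; rewrite /= e.
have gP (s : 'I_d2) : ((v + m * s) %/ d1 < n)%N.
  rewrite ltn_divLR // edges; have := ltn_ord s; have := ltn_ord v; nia.
pose g (s : 'I_d2) : 'I_n := Ordinal (gP s).
have gle (s s' : 'I_d2) : g s = g s' -> (s' <= s)%N.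
  move=> /(congr1 val) /= e; rewrite leqNgt; apply/negP => lt.
  have : ((v + m * s + d1) %/ d1 <= (v + m * s') %/ d1)%N by apply: leq_div2r; nia.
  by rewrite divnDr ?dvdnn // divnn d10 e addn1 ltnn.
have ginj : injective g.
  by move=> s s' e; apply/val_inj/eqP; rewrite eqn_leq !gle.
rewrite -[RHS](card_ord d2) -(card_codom ginj); apply: eq_card => u; rewrite !inE /=.
apply/existsP/codomP => [[t /eqP e]|[s ->]].
  have lt : ((u * d1 + t) %/ m < d2)%N.
    rewrite ltn_divLR // (mulnC d2) -edges; have := ltn_ord t; have := ltn_ord u; nia.
  exists (Ordinal lt); apply: val_inj => /=.
  rewrite -e addnC mulnC -divn_eq divnMDl // divn_small ?addn0 //.
exists (Ordinal (ltn_pmod (v + m * s) d10)) => /=.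
by rewrite -divn_eq addnC mulnC modnMDl modn_small.
Qed.

(** * Eigenvalue bounds for graphs outside the bad events *)

Section Deterministic.
Context (R : realType) (n m d1 d2 : nat).
Hypotheses (n_gt0 : (0 < n)%N) (m_gt0 : (0 < m)%N) (d1_gt0 : (0 < d1)%N) (d2_gt0 : (0 < d2)%N).
Hypotheses (edges : (n * d1 = m * d2)%N) (nm : (n <= m)%N).
Local Notation Omega := (biregular n m d1 d2).
Local Notation p := (d2%:R / n%:R : R).

(** The graph is a disjoint union of stars with [d1] leaves; AM-GM is weighted by [sqrt d1] to
    balance the degrees [d1] and 1. *)
Lemma eig2_le_trivial G : d2 = 1%N -> G \in Omega -> eig (adj_mx R G) 2 <= Num.sqrt d1%:R.
Proof.
move=> d21 GO; set r := Num.sqrt d1%:R; apply: eig2_adj_le; first exact: sqrtr_ge0.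
move=> x y _; have r0 : 0 < r by rewrite sqrtr_gt0 ltr0n.
have rr : r ^+ 2 = d1%:R by rewrite sqr_sqrtr.
apply: (@le_trans _ _ (\sum_u \sum_v (x u ^+ 2 / r / 2 * edge R n m G u v
    + r / 2 * y v ^+ 2 * edge R n m G u v))).
  apply: ler_sum => u _; apply: ler_sum => v _; rewrite -mulrDl ler_wpM2r ?ler0n //.
  rewrite -subr_ge0 (_ : _ - _ = (x u / r - y v) ^+ 2 * (r / 2)); last by field; rewrite gt_eqF.
  by rewrite mulr_ge0 ?sqr_ge0 // divr_ge0 // ltW.
under eq_bigr do rewrite big_split /=.
rewrite big_split /= (row_sum2 R n m d1 d2 G (fun u => x u ^+ 2 / r / 2) GO).
rewrite (col_sum2 R n m d1 d2 G (fun v => r / 2 * y v ^+ 2) GO) d21 mul1r.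
rewrite -mulr_sumr -!mulr_suml -rr le_eqVlt; apply/orP; left; apply/eqP.
by field; rewrite gt_eqF.
Qed.

(** The last term pays for the share of [p J] on heavy couples. *)
Definition second_const (c : R) : R := light_const R + heavy_const R c + 256.

Lemma second_const_ge0 (c : R) : 0 <= c -> 0 <= second_const c.
Proof.
move=> c0; rewrite /second_const /light_const /heavy_const.
have : 0 <= expR 4 * (4 * expR 4 + 2) :> R.
  by rewrite mulr_ge0 ?addr_ge0 ?mulr_ge0 ?expR_ge0.
by rewrite -(mulrA 256); set x := expR 4 * _; lra.
Qed.

Lemma eig2_le_good (c : R) G : 0 <= c -> G \in Omega ->
  (forall S T, S != set0 -> T != set0 -> ~~ discrepant R n m d2 c S T G) ->
  (forall k l, gball n k -> gball m l -> ~~ light_bad R n m d2 (k, l) G) ->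
  eig (adj_mx R G) 2 <= second_const c / 8 * Num.sqrt d1%:R.
Proof.
move=> c0 GO disc nbad.
have N0 : 0 < n%:R :> R by rewrite ltr0n.
have M0 : 0 < m%:R :> R by rewrite ltr0n.
have D0 : 0 < d2%:R :> R by rewrite ltr0n.
set r := Num.sqrt (d2%:R : R); have r0 : 0 < r by rewrite sqrtr_gt0.
have rr : r ^+ 2 = d2%:R by rewrite sqr_sqrtr // ltW.
have p0 : 0 < p by rewrite divr_gt0.
have C0 := second_const_ge0 c c0.
(* The edge count equates the scale [m sqrt d2] of the probabilistic bounds with the scale of
   [bilinear_le_grid] times [sqrt d1]. *)
have mrE : m%:R * r = Num.sqrt d1%:R * (Num.sqrt n%:R * Num.sqrt m%:R).
  have h : Num.sqrt n%:R * Num.sqrt d1%:R = Num.sqrt m%:R * r :> R.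
    by rewrite -!sqrtrM // -!natrM edges.
  rewrite mulrA (mulrC (Num.sqrt d1%:R)) h mulrAC -expr2 sqr_sqrtr // ltW //.
apply: eig2_adj_le; first by rewrite mulr_ge0 ?divr_ge0 ?sqrtr_ge0.
move=> x y xy0.
set L := second_const c / 16 * Num.sqrt d1%:R.
have -> : second_const c / 8 * Num.sqrt d1%:R / 2 = L by rewrite /L; field.
have := bilinear_le_grid R n m (fun u v => edge R n m G u v - p) L n_gt0 m_gt0.
move=> H; have {H} : forall x y, \sum_u \sum_v x u * y v * (edge R n m G u v - p)
    <= L * (\sum_u x u ^+ 2 + \sum_v y v ^+ 2).
  apply: H => k l kb lb.
  have -> : L * (16 * (Num.sqrt n%:R * Num.sqrt m%:R)) = second_const c * (m%:R * r).
    by rewrite mrE /L; field.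
  have lightE := nbad k l kb lb; rewrite /light_bad -ltNge /= in lightE.
  have heavyE := heavy_le R n m d1 d2 n_gt0 m_gt0 d2_gt0 edges nm c (gabs n k) (gabs m l) G
     c0 GO disc kb lb.
  have meanE := prod_sum_le R n m (fun u => gval R n k u ^+ 2) (fun v => gval R m l v ^+ 2)
     (fun u => sqr_ge0 _) (fun v => sqr_ge0 _) (gball_sum R n k kb) (gball_sum R m l lb).
  rewrite -/r in lightE heavyE.
  pose lt u v := light R n m d2 k l u v.
  apply: (@le_trans _ _ (\sum_u \sum_v (lt u v * edge R n m G u v - p * lt u v
     + (if r < (gabs n k u * gabs m l v)%:R then
          (gabs n k u * gabs m l v)%:R * edge R n m G u v else 0)
     + p / r * (gval R n k u ^+ 2 * gval R m l v ^+ 2)))).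
    apply: ler_sum => u _; apply: ler_sum => v _.
    have -> : (gabs n k u * gabs m l v)%:R = `|gval R n k u * gval R m l v|.
      by rewrite /gval !normrM !normrX normrN1 !expr1n !mul1r !normr_nat natrM.
    rewrite /lt /light -/r -exprMn; set z := gval R n k u * gval R m l v.
    have q0 : 0 <= p / r * z ^+ 2 by rewrite mulr_ge0 ?sqr_ge0 // divr_ge0 // ltW.
    case: leP => zr; first by rewrite addr0; lra.
    have e0 : 0 <= edge R n m G u v by exact: edge_ge0.
    have h1 : z * edge R n m G u v <= `|z| * edge R n m G u v by rewrite ler_wpM2r // ler_norm.
    (* On heavy couples [|z| <= z^2 / r], which is summable over the grid ball. *)
    have h2 : - (p * z) <= p / r * z ^+ 2.
      rewrite -mulrN -[leRHS]mulrA ler_wpM2l ?(ltW p0) //.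
      apply: le_trans (_ : `|z| <= _); first by rewrite -normrN ler_norm.
      rewrite mulrC ler_pdivlMr // -[z ^+ 2]ger0_norm ?sqr_ge0 // normrX expr2 ler_wpM2l // ltW //.
    by rewrite mul0r mulr0 subr0 add0r mulrBr (mulrC z p); lra.
  under eq_bigr do rewrite !big_split /= sumrN -!mulr_sumr.
  rewrite !big_split /= sumrN -!mulr_sumr.
  have h : p / r * (\sum_u \sum_v gval R n k u ^+ 2 * gval R m l v ^+ 2) <= 256 * (m%:R * r).
    apply: (@le_trans _ _ (p / r * (256 * (n%:R * m%:R)))).
      by rewrite ler_wpM2l ?meanE // divr_ge0 // ltW.
    rewrite le_eqVlt; apply/orP; left; apply/eqP.
    by rewrite -rr; field; rewrite !gt_eqF.
  have -> : second_const c * (m%:R * r) =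
      light_const R * (m%:R * r) + heavy_const R c * (m%:R * r) + 256 * (m%:R * r).
    by rewrite /second_const; move: (light_const R) (heavy_const R c) => a b; ring.
  apply: lerD; last by under [X in _ * X <= _]eq_bigr do rewrite mulr_sumr.
  by apply: lerD => //; rewrite lerBlDl ltW.
move/(_ x y); apply: le_trans.
(* Passing from [X - p J] back to [X] adds [p (sum x) (sum y)], nonpositive by [xy0]. *)
have -> : \sum_u \sum_v x u * y v * (edge R n m G u v - p) =
   \sum_u \sum_v x u * y v * edge R n m G u v - p * ((\sum_u x u) * (\sum_v y v)).
  rewrite mulr_suml mulr_sumr -sumrB; apply: eq_bigr => u _.
  rewrite mulrA mulr_sumr -sumrB; apply: eq_bigr => v _; ring.
by rewrite lerBrDr gerDl mulr_ge0_le0 // ltW.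
Qed.

End Deterministic.

(** * Assembly of the probability bound *)

Lemma uniform_pr_ge (R : realType) (T : finType) (S : {set T}) (P B1 B2 : pred T) (e1 e2 : R) :
  S != set0 ->
  (forall x, x \in S -> ~~ B1 x -> ~~ B2 x -> P x) ->
  #|[set x in S | B1 x]|%:R <= #|S|%:R * e1 ->
  #|[set x in S | B2 x]|%:R <= #|S|%:R * e2 ->
  1 - e1 - e2 <= uniform_pr R S P.
Proof.
move=> S0 good le1 le2; have c0 : 0 < #|S|%:R :> R by rewrite ltr0n card_gt0.
rewrite /uniform_pr ler_pdivlMr //.
have : #|S|%:R <= #|[set x in S | P x]|%:R + #|[set x in S | B1 x]|%:R + #|[set x in S | B2 x]|%:R :> R.
  rewrite -!natrD ler_nat.
  apply: leq_trans (leq_trans (leq_card_setU _ _) (leq_add (leq_card_setU _ _) (leqnn _))).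
  apply/subset_leq_card/subsetP => x xS; rewrite !inE xS /=.
  by have := good x xS; case: (B1 x); case: (B2 x); case: (P x) => //= ->.
by nra.
Qed.

Lemma cube_le_sqr (R : realType) (n d : nat) :
  d%:R <= 2^-1 * powR (n%:R : R) (2 / 3) -> (8 * d ^ 3 <= n ^ 2)%N.
Proof.
move=> h; have h2 : 2 * d%:R <= powR n%:R (2 / 3) :> R by lra.
have : (2 * d%:R) ^+ 3 <= powR (n%:R : R) (2 / 3) ^+ 3.
  by rewrite lerXn2r ?nnegrE ?powR_ge0 ?mulr_ge0.
rewrite -powR_mulrn ?powR_ge0 // -powRrM.
have -> : 2 / 3 * 3%:R = 2%:R :> R by field.
rewrite powR_mulrn // exprMn -!natrX -natrM ler_nat.
by [].
Qed.

Theorem theorem1p1 (R : realType) (K : R) (hK : 0 < K) :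
  exists2 alpha : R, 0 < alpha &
    forall n m d1 d2 : nat,
      (0 < n)%N -> (0 < m)%N -> (0 < d1)%N -> (0 < d2)%N ->
      (n * d1 = m * d2)%N ->
      (d1 <= m)%N -> (d2 <= n)%N -> (d2 <= d1)%N ->
      d2%:R <= 2^-1 * powR (n%:R : R) (2 / 3) ->
      1 - powR (m%:R : R) (- K) - expR (- (m%:R : R)) <=
        uniform_pr R (biregular n m d1 d2)
          (fun G => eig (adj_mx R G) 2 <= alpha * Num.sqrt d1%:R).
Proof.
have c0 : 0 <= K + 2 by rewrite addr_ge0 // ltW.
have C0 := second_const_ge0 R (K + 2) c0.
(* The summand 1 serves [d2 = 1], the other one [d2 >= 2]. *)
exists (1 + second_const R (K + 2) / 8); first by rewrite ltr_pwDl // divr_ge0.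
move=> n m d1 d2 n0 m0 d10 d20 edges d1m d2n d21 small.
have ne : biregular n m d1 d2 != set0 by exact: biregular_neq0.
have nm : (n <= m)%N by rewrite -(leq_pmul2r d10) edges leq_mul2l d21 orbT.
have cube := cube_le_sqr R n d2 small.
have [d2_1|d2_2] := leqP d2 1.
  have d2E : d2 = 1%N by apply/eqP; rewrite eqn_leq d2_1.
  apply: (uniform_pr_ge _ _ _ _ pred0 pred0) => //.
  - move=> G GO _ _; apply: le_trans (eig2_le_trivial R n m d1 d2 d10 G d2E GO) _.
    by rewrite ler_peMl ?sqrtr_ge0 // lerDl divr_ge0.
  - rewrite (_ : [set x in _ | _] = set0) ?cards0 ?mulr_ge0 ?powR_ge0 //.
    by apply/setP => G; rewrite !inE andbF.
  - rewrite (_ : [set x in _ | _] = set0) ?cards0 ?mulr_ge0 ?expR_ge0 //.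
    by apply/setP => G; rewrite !inE andbF.
(* Otherwise [8 d2^3 <= n^2 < 16 d2^2], which forces [d2 < 2]; hence the separate case above. *)
have d2_small : (4 * d2 <= n)%N.
  rewrite leqNgt; apply/negP => lt.
  have : (n ^ 2 < (4 * d2) ^ 2)%N by rewrite ltn_sqr.
  nia.
(* The cube bound gives [d2 sqrt d2 <= n], to be multiplied by [m sqrt d2] and compared with
   [n d1 d2 = m d2^2]. *)
have dm : d1%:R * d2%:R <= m%:R * Num.sqrt d2%:R :> R.
  have N0 : 0 < n%:R :> R by rewrite ltr0n.
  set r := Num.sqrt (d2%:R : R); have r0 : 0 <= r by exact: sqrtr_ge0.
  have rr : r ^+ 2 = d2%:R by rewrite sqr_sqrtr.
  have h : d2%:R * r <= n%:R.
    rewrite -(ler_pXn2r (n := 2)) ?nnegrE ?mulr_ge0 // exprMn rr -natrX -natrM -natrX ler_nat.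
    by apply: leq_trans cube; rewrite -expnSr leq_pmull.
  rewrite -(ler_pM2l N0) mulrA -natrM edges natrM.
  rewrite (_ : m%:R * d2%:R * d2%:R = m%:R * r * (d2%:R * r)); last by rewrite -[X in _ * X = _]rr; ring.
  by rewrite [leRHS]mulrC ler_wpM2l ?mulr_ge0.
apply: (uniform_pr_ge _ _ _ _
  (fun G => [exists (ST | (ST.1 != set0) && (ST.2 != set0)),
     discrepant R n m d2 (K + 2) ST.1 ST.2 G])
  (fun G => [exists (xy | gball n xy.1 && gball m xy.2), light_bad R n m d2 xy G])) => //.
- move=> G GO /existsPn nd /existsPn nl.
  apply: le_trans (_ : second_const R (K + 2) / 8 * Num.sqrt d1%:R <= _); last first.
    by rewrite ler_wpM2r ?sqrtr_ge0 // lerDr.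
  apply: (eig2_le_good R n m d1 d2) => //.
  - by move=> S T S0 T0; have := nd (S, T); rewrite /= S0 T0.
  - by move=> k l kb lb; have := nl (k, l); rewrite /= kb lb.
- by apply: discrepancy_union => //; exact: ltW.
- exact: light_union.
Qed.
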